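(* Let $n \geqslant k \geqslant 3$ be natural numbers. Then: (i) If $k$ is even, then $d_k(S_n)=2$. Moreover, $d_k(A_n)=2$ unless either $k \in \{n-1,n\}$ and $k$ is a power of $2$, or $(n,k)=(6,6)$. (ii) If $k$ is odd, then $d_k(A_n)=2$, except when $n=3$, in which case $d_3(A_3)=1$.
   Context: For a positive integer $k$ and a group $G$ that is generated by finitely many elements of order $k$, $d_k(G)$ denotes the smallest cardinality of a generating set of $G$ all of whose elements have order exactly $k$. $S_n$ and $A_n$ denote the symmetric and alternating groups on $\{1,\dots,n\}$. *)

(* Defs.v *)
From mathcomp Require Import all_boot all_fingroup all_solvable alt.
Set Implicit Arguments. Unset Strict Implicit. Unset Printing Implicit Defensive.
Local Open Scope group_scope.

Definition order_k_genset (gT : finGroupType) (k : nat) (G X : {set gT}) : bool :=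
  [&& X \subset G, [forall x in X, #[x] == k] & <<X>> == G].

Definition dk_is (gT : finGroupType) (k : nat) (G : {set gT}) (m : nat) : Prop :=
  (exists X : {set gT}, order_k_genset k G X /\ #|X| = m) /\
  (forall X : {set gT}, order_k_genset k G X -> m <= #|X|).

(* Main.v *)
(** If a has order k >= 3, t is an involution and <a, t> contains A_n with n >= 5, then
    <a, a^t> is normalised by <a, t>, so by simplicity of A_n it is A_n or S_n according to the
    parity of a. Such pairs are built so that a t is a long cycle times a transposition or a
    3-cycle tau of coprime order: then tau is a power of a t, and tau together with transitivity
    forces <a, t> to contain A_n. To reach every n, start from one cycle of a (and a
    t with two or four moved points) and repeatedly attach to a point fixed by t a new cycle
    of a (possibly of length 1) by a transposition of t; this merges the new cycle into the
    long cycle of a t and changes nothing else.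

    For odd k this misses n = 2k - 1 and n = 2k - 2, where two k-cycles with one or two
    common points produce a 3-cycle. Ten small pairs (n, k) are settled by explicit
    generators. *)
Require Import Defs.
From mathcomp Require Import all_boot all_fingroup all_solvable alt.
From mathcomp Require Import zify.
Set Implicit Arguments. Unset Strict Implicit. Unset Printing Implicit Defensive.

Local Open Scope group_scope.

(** * Cycles given by sequences *)

(** What governs every count is the supply of spare points, the points of the long cycle that [t]
    fixes: attaching a cycle of length d uses up one and supplies d - 1. So the fixed points of [a]
    are the expensive part. For odd k a single k-cycle leaves at most k - 3 spare points and
    therefore stops at n = 2k - 3, while two k-cycles start at n = 2k. For even k, 2-cycles of [a]
    cost nothing, and pairs of them do not disturb the parity of [a].

    The second constraint is coprimality: the long cycle must have odd length if tau is a
    transposition, and length prime to 3 if tau is a 3-cycle. When n has the wrong residue, one more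
    point is made a fixed point of [a * t].

    The exceptions in (i) come from a lack of elements: if k is a power of 2 and n is k or k + 1, an
    element of order k is a k-cycle, hence odd; in S_6 the elements of order 6 are all odd too.
    Close to these cases, [a] has to be assembled from shorter cycles whose lengths have least
    common multiple k. *)

Section Cycles.
Variable T : finType.
Implicit Types (x y z p q : T) (s r : seq T) (g h : {perm T}).

(* Permutations compose from left to right, so this maps x to the first element
   of s', each element of s' to the next one, and the last one back to x. *)
Definition cyc s : {perm T} :=
  if s is x :: s' then \prod_(y <- s') tperm x y else 1.

Lemma cyc1 x : cyc [:: x] = 1.
Proof. by rewrite /= big_nil. Qed.

Lemma cyc2 x y : cyc [:: x; y] = tperm x y.
Proof. by rewrite /= big_seq1. Qed.

(** Carrying [tperm p q] to the left across a factor [tperm q z] turns that factor into [tperm p z].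
    Every attachment of a cycle to the long cycle is an instance. *)
Lemma cyc_merge p q r s : p \notin s -> q \notin s ->
  cyc (p :: r) * cyc (q :: s) * tperm p q = cyc (p :: r ++ q :: s).
Proof.
move=> ps qs; rewrite /= big_cat big_cons /= -!mulgA; congr (_ * _).
elim: s ps qs => [|z s IH]; first by rewrite !big_nil mul1g mulg1.
rewrite !inE !negb_or !big_cons => /andP[pz ps] /andP[qz qs].
by rewrite -mulgA IH // !mulgA; congr (_ * _); rewrite conjgC tpermJ tpermR tpermD.
Qed.

Lemma cyc_cons p q s : p \notin s -> q \notin s ->
  cyc (p :: q :: s) = cyc (q :: s) * tperm p q.
Proof. by move=> ps qs; rewrite -(cyc_merge [::] ps qs) cyc1 mul1g. Qed.

(** Induction through [cyc_cons]: putting x in front of y redirects to x the arrow that used to end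
    in y. *)
Lemma cycE s : uniq s -> cyc s =1 next s.
Proof.
case: s => [|x s] Us w; first by rewrite perm1.
elim: s x Us => [|y s IH] x; first by rewrite cyc1 perm1 /=; case: eqP.
rewrite [uniq _]/= inE negb_or => /andP[/andP[xy xs] Us].
have /andP[ys _] := Us.
rewrite cyc_cons // permM IH //= {IH}.
have [->|wx] := eqVneq w x.
  suff ->: next_at x y y s = x by rewrite tpermL.
  elim: s {1 3}y xy xs {Us ys} => [|z s IH] y0 /=; first by case: eqP.
  by rewrite inE negb_or => /negPf-> /andP[/IH].
have [ws|ws] := boolP (w \in y :: s); last first.
  have E a: next_at w a y s = w.
    elim: s y ws {xy xs ys Us} => [|z s IH] y0 /=.
      by rewrite inE => /negPf->.
    by rewrite inE negb_or => /andP[/negPf-> /IH].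
  move: ws; rewrite inE negb_or => /andP[wy _].
  by rewrite !E tpermD // eq_sym.
(* The second argument of [next_at] is the value returned at the end of the list, where the cycle
   closes; only there do the two sides take x and y. *)
suff E: forall y0, w \in y0 :: s -> next_at w x y0 s = tperm x y (next_at w y y0 s).
  by rewrite E.
elim: s xs ys {Us ws} => [|z s IH] xs ys y0 /=.
  by rewrite inE => ->; rewrite tpermR.
move: xs ys; rewrite inE => + + /orP; rewrite !inE !negb_or.
move=> /andP[xz xs] /andP[yz ys]; case: eqP => [_ _|_ [//|ws]] /=; last exact: IH.
by rewrite tpermD // eq_sym.
Qed.

Lemma cyc_id s y : uniq s -> y \notin s -> cyc s y = y.
Proof. by move=> Us /negPf ys; rewrite cycE // next_nth ys. Qed.

Lemma mem_cyc s y : uniq s -> (cyc s y \in s) = (y \in s).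
Proof. by move=> Us; rewrite cycE // mem_next. Qed.

Lemma cyc_rot n s : uniq s -> cyc (seq.rot n s) = cyc s.
Proof. by move=> Us; apply/permP=> y; rewrite !cycE ?rot_uniq // next_rot. Qed.

Lemma cyc_catC s r : uniq (s ++ r) -> cyc (s ++ r) = cyc (r ++ s).
Proof. by move=> U; rewrite -(rot_size_cat s r) cyc_rot. Qed.

Lemma cyc_perm_on s : uniq s -> perm_on [set y in s] (cyc s).
Proof.
move=> Us; apply/subsetP=> y; rewrite !inE; apply: contraNT.
by move=> ys; rewrite cyc_id.
Qed.

Lemma odd_cyc s : uniq s -> odd_perm (cyc s) = odd (size s).-1.
Proof.
case: s => [|x s] /=; first by rewrite odd_perm1.
case/andP=> + _; elim: s => [|y s IH]; first by rewrite big_nil odd_perm1.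
by rewrite inE negb_or big_cons odd_permM odd_tperm => /andP[-> /IH->] /=.
Qed.

Lemma fcycle_cyc s : uniq s -> fcycle (cyc s) s.
Proof.
by move=> Us; rewrite (eq_cycle (e' := frel (next s))) ?cycle_next // => x y /=; rewrite cycE.
Qed.

Lemma fconnect_cyc s x y : uniq s -> x \in s -> y \in s -> fconnect (cyc s) x y.
Proof. by move=> Us xs ys; rewrite (fconnect_cycle (fcycle_cyc Us)). Qed.

Lemma order_cyc s : uniq s -> s != [::] -> #[cyc s] = size s.
Proof.
move=> Us; case: s Us => // x s Us _.
have O y : y \in x :: s -> fingraph.order (cyc (x :: s)) y = size (x :: s).
  by move=> ys; rewrite (order_cycle (fcycle_cyc Us)).
apply/eqP; rewrite eqn_dvd; apply/andP; split.
  rewrite order_dvdn; apply/eqP/permP=> y; rewrite permX perm1.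
  have [ys|ys] := boolP (y \in x :: s).
    by rewrite -{1}(O y ys) iter_order //; apply: perm_inj.
  by apply: iter_fix; apply: cyc_id.
rewrite -(O x (mem_head _ _)).
set f := cyc _; set o := fingraph.order f x.
have o0 : 0 < o by apply: fingraph.order_gt0.
rewrite /dvdn; apply/eqP.
have xx : iter (#[f] %% o) f x = x.
  have: (f ^+ #[f]) x = x by rewrite expg_order perm1.
  rewrite {1}(divn_eq #[f] o) addnC permX iterD.
  suff ->: iter (#[f] %/ o * o) f x = x by [].
  elim: (_ %/ _) => // n IH; rewrite mulSn iterD IH iter_order //.
  exact: perm_inj.
have lt: #[f] %% o < o by rewrite ltn_mod.
have := findex_iter lt; rewrite xx => <-.
by rewrite findex0.
Qed.

(** The m-th power of [f * k] is [f ^+ m], which by coprimality still generates [<[f]>]. This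
    extracts one factor from a product of disjoint cycles. *)
Lemma mem_cycle_mul (gT : finGroupType) (f k : gT) m :
  commute f k -> k ^+ m = 1 -> coprime #[f] m -> f \in <[f * k]>.
Proof.
move=> fk km cop.
have fX : f ^+ m \in <[f * k]> by rewrite -[f ^+ m]mulg1 -km -expgMn // mem_cycle.
suff: f \in <[f ^+ m]> by apply/subsetP; rewrite cycle_subG.
have : generator <[f]> (f ^+ m) by rewrite generator_coprime.
by rewrite /generator => /eqP<-; rewrite cycle_id.
Qed.

Lemma order_mul_disjoint (A B : {set T}) g h :
  perm_on A g -> perm_on B h -> [disjoint A & B] ->
  #[g * h] = lcmn #[g] #[h].
Proof.
move=> gA hB AB; have gh : commute g h by apply: perm_onC gA hB AB.
apply/eqP; rewrite eqn_dvd; apply/andP; split.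
  rewrite order_dvdn expgMn //.
  have /dvdnP[u {1}->] := dvdn_lcml #[g] #[h].
  have /dvdnP[v ->] := dvdn_lcmr #[g] #[h].
  by rewrite mulnC expgM expg_order expg1n mul1g mulnC expgM expg_order expg1n.
have E : g ^+ #[g * h] * h ^+ #[g * h] = 1 by rewrite -expgMn // expg_order.
have onX C (k : {perm T}) m : perm_on C k -> perm_on C (k ^+ m).
  by move=> kC; elim: m => [|m IH]; rewrite ?expg0 ?perm_on1 // expgS perm_onM.
have G : g ^+ #[g * h] = 1.
  apply/permP=> x; rewrite perm1.
  have [xA|xA] := boolP (x \in A); last by rewrite (out_perm (onX _ _ _ gA)).
  have := congr1 (fun k : {perm T} => k x) E; rewrite /= permM perm1.
  rewrite (out_perm (onX _ _ _ hB)) //.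
  by rewrite (disjointFr AB) // perm_closed ?onX.
have H : h ^+ #[g * h] = 1 by move: E; rewrite G mul1g.
by rewrite dvdn_lcm !order_dvdn G H eqxx.
Qed.

End Cycles.

(** * Blocks of transpositions and of 3-cycles *)

Section Blocks.
Variable T : finType.
Implicit Types (x y z u v w c : T) (f g h : {perm T}) (G : {group {perm T}}).

(* Transitivity of the group generated by f and g, as seen from the point c. *)
Definition orbit_full c f g :=
  forall B : {set T}, c \in B -> {in B, forall v, f v \in B} ->
  {in B, forall v, g v \in B} -> forall v, v \in B.

(** The class of u is stable under f because it contains u and [f u], and under g because it
    contains v and [g v]. Transitivity then leaves a single class; this takes the place of a
    primitivity argument. *)
Lemma block_full (R : rel T) f g c u v :
    symmetric R -> transitive R ->
    (forall x y, R x y -> R (f x) (f y)) -> (forall x y, R x y -> R (g x) (g y)) ->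
    orbit_full c f g -> R u v -> R u (f u) -> R v (g v) ->
  forall x y, R x y.
Proof.
move=> Rs Rt Rf Rg cfg uv uf vg.
pose B := [set x | R u x].
have Bf : {in B, forall x, f x \in B}.
  by move=> x; rewrite !inE => /Rf; apply: Rt.
have Bg : {in B, forall x, g x \in B}.
  move=> x; rewrite !inE => ux; apply: (Rt _ _ _ uv); apply: (Rt _ _ _ vg); apply: Rg.
  by apply: Rt ux; rewrite Rs.
(* [orbit_full] starts at c, which may lie outside the class of u; then the complement is used,
   which is stable as well because h is a bijection. *)
have stC h : {in B, forall x, h x \in B} -> {in ~: B, forall x, h x \in ~: B}.
  move=> Bh x; rewrite !in_setC; apply: contraNN => hx.
  have: h @: B = B.
    apply/eqP; rewrite eqEcard card_imset ?leqnn ?andbT; last exact: perm_inj.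
    by apply/subsetP=> _ /imsetP[y yB ->]; apply: Bh.
  by move/setP/(_ (h x)); rewrite mem_imset ?hx //; apply: perm_inj.
have uB : u \in B by rewrite inE; apply: (Rt _ _ _ uf); rewrite Rs.
have full x : x \in B.
  have [cB|cB] := boolP (c \in B); first exact: cfg.
  have := cfg (~: B) _ (stC _ Bf) (stC _ Bg) u.
  by rewrite !in_setC uB => /(_ cB).
by move=> x y; have := full x; have := full y; rewrite !inE Rs => uy ux; rewrite Rs; apply: (Rt _ _ _ uy).
Qed.

Lemma tperm_trans G x y z : tperm x y \in G -> tperm y z \in G -> tperm x z \in G.
Proof.
move=> xy yz; have [<-|xz] := eqVneq x z; first by rewrite tperm1 group1.
have [<-//|yx] := eqVneq y x.
by have := groupJ xy yz; rewrite tpermJ tpermL tpermD // eq_sym.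
Qed.

(** The relation [tperm x y \in G] is an equivalence, and conjugation by f and g preserves it, so
    [block_full] puts every transposition into G. *)
Lemma tperm_full G f g c u v : f \in G -> g \in G ->
    orbit_full c f g -> tperm u v \in G -> tperm u (f u) \in G ->
    tperm v (g v) \in G ->
  G :=: setT.
Proof.
move=> fG gG cfg uv uf vg.
have RJ h : h \in G -> forall x y, tperm x y \in G -> tperm (h x) (h y) \in G.
  by move=> hG x y xy; rewrite -tpermJ groupJ.
have all_t : forall x y, tperm x y \in G.
  apply: (@block_full (fun x y => tperm x y \in G) f g c u v) => //.
  - by move=> x y; rewrite tpermC.
  - by move=> y x z; apply: tperm_trans.
  - exact: RJ.
  - exact: RJ.
apply/eqP; rewrite eqEsubset subsetT -(gen_tperm u) gen_subG.
by apply/subsetP=> _ /imsetP[y _ ->].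
Qed.

(** The analogue for 3-cycles of [tperm x y \in G]. Leaving the third point free makes the relation
    transitive, and the diagonal is added for reflexivity. *)
Definition cyc3_rel G : rel T :=
  fun x y => (x == y) || [exists z, uniq [:: x; y; z] && (cyc [:: x; y; z] \in G)].

Lemma cyc3E x y z : cyc [:: x; y; z] = tperm x y * tperm x z.
Proof. by rewrite /= !big_cons big_nil mulg1. Qed.

Lemma cyc3J x y z h : cyc [:: x; y; z] ^ h = cyc [:: h x; h y; h z].
Proof. by rewrite !cyc3E conjMg !tpermJ. Qed.

Lemma cyc3_rot x y z : uniq [:: x; y; z] -> cyc [:: y; z; x] = cyc [:: x; y; z].
Proof. exact: (@cyc_rot _ 1). Qed.

Lemma uniq3_rot x y z : uniq [:: x; y; z] -> uniq [:: y; z; x].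
Proof. by rewrite -(rot_uniq 1). Qed.

Lemma cyc3V x y z : (cyc [:: x; y; z])^-1 = cyc [:: x; z; y].
Proof. by rewrite !cyc3E invMg !tpermV. Qed.

(** If v = x, the inverse of the second 3-cycle sends x to z. Otherwise the second 3-cycle fixes x
    and sends y to z, so it conjugates the first into one that sends x to z. *)
Lemma cyc3_trans G x y z u v : uniq [:: x; y; u] -> uniq [:: y; z; v] -> x != z ->
    cyc [:: x; y; u] \in G -> cyc [:: y; z; v] \in G ->
  exists w, uniq [:: x; z; w] && (cyc [:: x; z; w] \in G).
Proof.
move=> U1 U2 xz G1 G2.
have [vx|vx] := eqVneq v x.
  rewrite {}vx in U2 G2; have U3 := uniq3_rot (uniq3_rot U2).
  exists y; rewrite -cyc3V groupV -(cyc3_rot U3) G2 andbT.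
  by move: U3; rewrite /= !inE !negb_or [y == z]eq_sym !andbT => /andP[/andP[-> ->]].
have xE : cyc [:: y; z; v] x = x.
  rewrite cyc_id //; move: U1; rewrite /= !inE !negb_or [x == v]eq_sym vx xz.
  by case/andP=> /andP[->].
have yE : cyc [:: y; z; v] y = z by rewrite cycE //= eqxx.
exists (cyc [:: y; z; v] u).
have := groupJ G1 G2; rewrite cyc3J xE yE => ->; rewrite andbT.
by have := U1; rewrite -(map_inj_uniq (@perm_inj _ (cyc [:: y; z; v]))) /= xE yE.
Qed.

Lemma cyc3_relJ G h x y : h \in G -> cyc3_rel G x y -> cyc3_rel G (h x) (h y).
Proof.
move=> hG /orP[/eqP->|/existsP[z /andP[U cG]]]; first by rewrite /cyc3_rel eqxx.
apply/orP; right; apply/existsP; exists (h z); rewrite -cyc3J groupJ // andbT.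
by rewrite -(map_inj_uniq (@perm_inj _ h)) in U.
Qed.

Lemma cyc3_rel_sym G : symmetric (cyc3_rel G).
Proof.
suff S x y : cyc3_rel G x y -> cyc3_rel G y x by move=> x y; apply/idP/idP; apply: S.
move=> /orP[/eqP->|/existsP[z /andP[U cG]]]; first by rewrite /cyc3_rel eqxx.
apply/orP; right; apply/existsP; exists z; move: U cG.
move=> U; rewrite -groupV cyc3V => cG.
have U' : uniq [:: x; z; y].
  by move: U; rewrite /= !inE !negb_or [y == z]eq_sym !andbT => /andP[/andP[-> ->]].
by rewrite (cyc3_rot (uniq3_rot U')) (cyc3_rot U') cG (uniq3_rot (uniq3_rot U')).
Qed.

Lemma cyc3_rel_trans G : transitive (cyc3_rel G).
Proof.
move=> y x z /orP[/eqP->//|/existsP[u /andP[U1 G1]]].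
move=> /orP[/eqP<-|/existsP[v /andP[U2 G2]]].
  by apply/orP; right; apply/existsP; exists u; rewrite U1.
have [->|xz] := eqVneq x z; first by rewrite /cyc3_rel eqxx.
by apply/orP; right; apply/existsP; apply: cyc3_trans U1 U2 xz G1 G2.
Qed.

(** Some (x y u) lies in G, and u has to be replaced by w. With (u w v) in G, conjugation by it does
    so when v is neither x nor y; in these two cases conjugation by its inverse gives the inverse of
    (x y w). *)
Lemma cyc3_full G : (forall x y, cyc3_rel G x y) ->
  forall x y w, uniq [:: x; y; w] -> cyc [:: x; y; w] \in G.
Proof.
move=> RG x y w Uxyw; have := Uxyw; rewrite /= !inE negb_or andbT => /andP[/andP[xy xw] yw].
have /orP[|/existsP[u /andP[Uu Gu]]] := RG x y; first by rewrite (negPf xy).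
have [<-//|uw] := eqVneq u w.
have /orP[|/existsP[v /andP[Uv Gv]]] := RG u w; first by rewrite (negPf uw).
move: (Uu); rewrite /= !inE negb_or andbT => /andP[/andP[_ xu] yu].
have uE : cyc [:: u; w; v] u = w by rewrite cycE //= eqxx.
have wE : cyc [:: u; w; v] w = v by rewrite cycE //= eqxx eq_sym (negPf uw).
have vE : cyc [:: u; w; v] v = u.
  by rewrite -(cyc3_rot Uv) -(cyc3_rot (uniq3_rot Uv)) cycE ?(uniq3_rot (uniq3_rot Uv)) //= eqxx.
have out a : a != u -> a != w -> a != v -> cyc [:: u; w; v] a = a.
  by move=> au aw av; rewrite cyc_id // !inE !negb_or au aw.
have GJ := groupJ Gu Gv; have GJV := groupJ Gu (groupVr Gv).
rewrite !cyc3J in GJ GJV.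
have VE a b : cyc [:: u; w; v] a = b -> (cyc [:: u; w; v])^-1 b = a.
  by move<-; rewrite permK.
have [vx|vx] := eqVneq x v.
  subst v; move: GJV; rewrite (VE w x) // (VE x u) // (VE y y) ?out // 1?eq_sym //.
  rewrite -groupV cyc3V -(cyc3_rot (x := w)) //.
  exact: uniq3_rot (uniq3_rot Uxyw).
have [vy|vy] := eqVneq y v.
  by subst v; move: GJV; rewrite (VE x x) ?out // (VE w y) // (VE y u) // -groupV cyc3V.
by move: GJ; rewrite uE !out.
Qed.

Lemma cyc3_Alt G : (forall x y w, uniq [:: x; y; w] -> cyc [:: x; y; w] \in G) ->
  Alt T \subset G.
Proof.
move=> c3; apply/subsetP=> s; rewrite Alt_even.
have t2 a b c : a != b -> b != c -> tperm a b * tperm b c \in G.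
  move=> ab bc; have [<-|ac] := eqVneq a c; first by rewrite [tperm b a]tpermC tperm2.
  by rewrite [tperm a b]tpermC -cyc3E c3 //= !inE negb_or eq_sym ab bc ac.
have tt a b c d : a != b -> c != d -> tperm a b * tperm c d \in G.
  move=> ab cd; have [bcE|bc] := eqVneq b c; first by rewrite -bcE t2 // bcE.
  (* Inserting [tperm b c] twice makes neighbouring transpositions share a point. *)
  rewrite -[tperm a b]mulg1 -(tperm2 b c) mulgA -(mulgA (_ * _)) groupM ?t2 //.
have [ts E dts] := prod_tpermP s; rewrite {s}E.
rewrite odd_perm_prod // => ets.
have [n] := ubnP (size ts); elim: n ts dts ets => // n IH [|[a b] [|[c d] ts]] //=.
  by rewrite big_nil group1.
case/and3P=> ab cd dts; rewrite negbK => ets tsn.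
by rewrite !big_cons /= mulgA groupM ?tt ?IH //; lia.
Qed.

Lemma cyc3_orbit_full G f g c u v : f \in G -> g \in G ->
    orbit_full c f g -> cyc3_rel G u v -> cyc3_rel G u (f u) ->
    cyc3_rel G v (g v) ->
  Alt T \subset G.
Proof.
move=> fG gG cfg uv uf vg; apply/cyc3_Alt/cyc3_full.
apply: (block_full (cyc3_rel_sym G) (@cyc3_rel_trans G) _ _ cfg uv uf vg) => x y.
- exact: cyc3_relJ.
- exact: cyc3_relJ.
Qed.

End Blocks.

(** The lower bound holds because a set with at most one element generates a cyclic, hence abelian,
    group. *)
Lemma dk_is2 (gT : finGroupType) (k : nat) (G : {group gT}) (x y : gT) :
    #[x] = k -> #[y] = k -> <<[set x; y]>> = G -> ~~ abelian G ->
  dk_is k G 2.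
Proof.
move=> xk yk gG nG.
have small (X : {set gT}) : <<X>> = G -> 1 < #|X|.
  move=> XG; rewrite ltnNge; apply: contra nG => X1.
  have [X0|[z zX]] := set_0Vmem X; first by rewrite -XG X0 gen0 abelian1.
  have /eqP XE : [set z] == X by rewrite eqEcard sub1set zX cards1.
  by rewrite -XG -XE cycle_abelian.
split; last by move=> X /and3P[_ _ /eqP/small].
exists [set x; y]; split; last first.
  by have := small _ gG; rewrite cards2; case: eqP.
apply/and3P; split; last by rewrite gG.
  by rewrite -gG subset_gen.
by apply/forall_inP=> z /set2P[] ->; rewrite ?xk ?yk.
Qed.

(** * From (a, t) to (a, a ^ t) *)

Section Reduction.
Variable T : finType.
Implicit Types a t : {perm T}.

Lemma Alt_nonabelian : 3 < #|T| -> ~~ abelian (Alt T).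
Proof.
move=> T4; apply/negP=> /centsP cAlt.
have [s Us sT] : exists2 s : seq T, uniq s & size s > 3.
  by exists (enum T); rewrite ?enum_uniq // -cardE.
case: s Us sT => [|x [|y [|z [|w s]]]] // Us _.
have Uxyz : uniq [:: x; y; z] by move: Us; rewrite -(cat_take_drop 3 [:: x, y, z, w & s]) cat_uniq => /andP[].
have Uyzw : uniq [:: y; z; w] by move: Us => /= /and4P[_ + + _]; rewrite /= !inE !negb_or => /and3P[-> ->] _ /andP[->].
have := cAlt (cyc [:: x; y; z]) _ (cyc [:: y; z; w]) _.
rewrite !Alt_even !odd_cyc // => /(_ isT isT) /(congr1 (fun f : {perm T} => f x)).
have xn : x \notin [:: y; z; w].
  by case/andP: Us => + _; rewrite !inE !negb_or => /and4P[-> -> ->].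
have E1 : cyc [:: y; z; w] x = x by rewrite cyc_id.
have E2 : cyc [:: x; y; z] x = y by rewrite cycE //= eqxx.
have E3 : cyc [:: y; z; w] y = z by rewrite cycE //= eqxx.
rewrite !permM E1 E2 E3 => zy; case/andP: Uyzw.
by rewrite inE negb_or zy eqxx.
Qed.

Lemma gen_conj_involution (k : nat) a t : 4 < #|T| -> 2 < k -> #[a] = k ->
    t * t = 1 -> Alt T \subset <<[set a; t]>> ->
  <<[set a; a ^ t]>> = if odd_perm a then Sym T else Alt T.
Proof.
move=> T5 k2 ak tt AG; set N := <<_>>.
have aN : a \in N by rewrite mem_gen ?set21.
have atN : a ^ t \in N by rewrite mem_gen ?set22.
(* As t is an involution, conjugation by t exchanges the two generators of N. *)
have nN : <<[set a; t]>> \subset 'N(N).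
  rewrite gen_subG; apply/subsetP=> _ /set2P[->|->].
    exact: (subsetP (normG _)).
  rewrite inE -genJ gen_subG; apply/subsetP=> _ /imsetP[x /set2P[] -> ->] //.
  by rewrite -conjgM tt conjg1.
have AN : Alt T \subset N.
  (* N :&: Alt T is normal in the simple group Alt T and contains a ^+ 2 != 1. *)
  have /simpleP[_ simA] := simple_Alt5 T5.
  have nNA : N :&: Alt T <| Alt T.
    by rewrite /normal subsetIr normsI ?normG // (subset_trans AG).
  case: (simA [group of N :&: Alt T] nNA) => /= [E|<-]; last by rewrite subsetIl.
  have: a ^+ 2 \in N :&: Alt T.
    by rewrite inE groupX // Alt_even expgS expg1 odd_permM addbb.
  by rewrite E inE -order_dvdn ak => kd; have := @dvdn_leq k 2 isT kd; rewrite leqNgt k2.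
apply/eqP; rewrite eqEsubset; case: ifP => oa; rewrite ?AN ?andbT; last first.
  rewrite gen_subG; apply/subsetP=> _ /set2P[]->; rewrite Alt_even ?odd_permJ oa //.
rewrite subsetT; apply/subsetP=> g _.
have [og|eg] := boolP (odd_perm g); last by rewrite (subsetP AN) // Alt_even.
rewrite -[g](mulgK a) groupM ?groupV // (subsetP AN) //.
by rewrite Alt_even odd_permM og oa.
Qed.

End Reduction.

Lemma order3_A3 : dk_is 3 (Alt 'I_3) 1.
Proof.
have c3 : #|Alt 'I_3| = 3.
  by have := card_Alt (T := 'I_3); rewrite card_ord => /(_ isT); rewrite (_ : 3`! = 2 * 3)%N // => /eqP; rewrite eqn_mul2l => /eqP.
split; last first.
  move=> X /and3P[_ _ /eqP XG]; rewrite card_gt0; apply/eqP=> X0.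
  by move: c3; rewrite -XG X0 gen0 cards1.
have /cyclicP[x xG] : cyclic (Alt 'I_3) by apply: prime_cyclic; rewrite c3.
exists [set x]; rewrite cards1; split=> //; apply/and3P; split.
- by rewrite xG sub1set cycle_id.
- by apply/forall_inP=> _ /set1P->; rewrite /order -xG c3.
- by rewrite xG.
Qed.

(** * Growing the pair (a, t) *)

Section Config.
Variable T : finType.
Implicit Types (x y z p q c : T) (s D F L S X : seq T) (a t tau : {perm T}).

(* The pair (a, t) lives on the points F ++ L, and a * t is the cycle L times tau; F collects
   the points moved by tau and fixed points of a * t. The spare points S are the points of L
   where a new transposition may still be multiplied into the involution t. *)
Record config tau c a t F L S : Prop := Config {
  config_uniq : uniq (F ++ L);
  config_spare : uniq S /\ {in S, forall p, p \in L /\ t p = p};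
  config_ona : perm_on [set x in F ++ L] a;
  config_ont : perm_on [set x in F ++ L] t;
  config_inv : t * t = 1;
  config_prod : a * t = tau * cyc L;
  config_tau : perm_on [set x in F] tau;
  config_orbit : forall B : {set T}, c \in B ->
     {in B, forall v, a v \in B} -> {in B, forall v, t v \in B} ->
     {subset F ++ L <= B} }.

Lemma perm_on_sub (A B : {set T}) a : A \subset B -> perm_on A a -> perm_on B a.
Proof. by move=> AB aA; apply: subset_trans AB. Qed.

Lemma rot_head p L : p \in L -> uniq L ->
  exists R, [/\ cyc (p :: R) = cyc L, perm_eq (p :: R) L & uniq (p :: R)].
Proof.
move=> pL UL; exists (behead (seq.rot (index p L) L)).
have rotE : p :: behead (seq.rot (index p L) L) = seq.rot (index p L) L.
  by rewrite rot_index.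
by rewrite rotE cyc_rot // perm_rot rot_uniq perm_refl.
Qed.

Lemma cyc_stable s (B : {set T}) x : uniq s -> x \in s -> x \in B ->
  {in s, forall y, y \in B -> cyc s y \in B} -> {subset s <= B}.
Proof.
move=> Us xs xB st y ys.
have := fconnect_cyc Us xs ys.
move/iter_findex; set i := findex _ _ _; move=> <-.
suff: (iter i (cyc s) x \in s) && (iter i (cyc s) x \in B) by case/andP.
elim: i => [|i /andP[IH1 IH2]] /=; first by rewrite xs xB.
by rewrite mem_cyc // IH1 st.
Qed.

(** The new cycle commutes with t, so [a * t] is multiplied on the right by
    [cyc (d :: D) * tperm p d], and [cyc_merge] inserts the cycle into L. The points p and d are now
    moved by the involution, while those of D become spare. *)
Lemma config_attach tau c a t F L p S d D :
    config tau c a t F L (p :: S) -> uniq (d :: D) ->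
    {in d :: D, forall y, y \notin F ++ L} ->
  exists R, [/\ perm_eq (p :: R) L,
    config tau c (a * cyc (d :: D)) (t * tperm p d) F (p :: R ++ d :: D) (S ++ D),
    #[a * cyc (d :: D)] = lcmn #[a] (size D).+1,
    odd_perm (a * cyc (d :: D)) = odd_perm a (+) odd (size D) &
    {in F ++ L, a * cyc (d :: D) =1 a}].
Proof.
move=> [UFL [/andP[pS US] inS] ona ont tt prod ontau orb] UD freshD.
have [pL tp] := inS p (mem_head _ _).
have [UF FL UL] : [/\ uniq F, ~~ has (mem F) L & uniq L] by move: UFL; rewrite cat_uniq => /and3P[].
have [R [cR pR UR]] := rot_head pL UL.
have pFL : p \in F ++ L by rewrite mem_cat pL orbT.
have LD y : y \in F ++ L -> y \notin d :: D.
  by move=> yL; apply/negP=> /freshD; rewrite yL.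
have pD : p \notin D by have := LD p pFL; rewrite inE negb_or => /andP[].
have dD : d \notin D by case/andP: UD.
have dis : [disjoint [set x in F ++ L] & [set x in d :: D]].
  rewrite disjoint_subset; apply/subsetP=> y; rewrite !inE => yFL.
  by have := LD y yFL; rewrite inE.
have onD := cyc_perm_on UD.
have tD : t * cyc (d :: D) = cyc (d :: D) * t by apply: perm_onC ont onD dis.
have td : t d = d by apply: (out_perm ont); rewrite inE; apply: freshD; rewrite mem_head.
have memR y : (y \in p :: R) = (y \in L) by apply: perm_mem.
have memL' y : (y \in F ++ p :: R ++ d :: D) = (y \in F ++ L) || (y \in d :: D).
  by rewrite -cat_cons !mem_cat memR orbA.
have subFL : [set x in F ++ L] \subset [set x in F ++ p :: R ++ d :: D].
  by apply/subsetP=> y; rewrite !inE memL' => ->.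
have subD : [set x in d :: D] \subset [set x in F ++ p :: R ++ d :: D].
  by apply/subsetP=> y; rewrite !inE memL' !inE => ->; rewrite orbT.
have agree : {in F ++ L, a * cyc (d :: D) =1 a}.
  move=> y yFL; rewrite permM cyc_id //; apply: LD.
  by have := perm_closed y ona; rewrite !inE yFL.
exists R; split=> //; first last.
- by rewrite odd_permM odd_cyc.
- by rewrite (order_mul_disjoint ona onD dis) order_cyc.
have UFL' : uniq (F ++ p :: R ++ d :: D).
  rewrite -cat_cons catA cat_uniq UD andbT.
  have -> : uniq (F ++ p :: R) by rewrite (perm_uniq (s2 := F ++ L)) // perm_cat2l.
  apply/hasPn=> y /freshD; apply: contra => /=.
  by rewrite !mem_cat memR.
split=> //.
- split.
    have UD' : uniq D by case/andP: UD.
    rewrite cat_uniq [uniq S]US UD' andbT andTb.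
    apply/hasPn=> y yD; apply/negP=> yS.
    have [|yL _] := inS y; first by rewrite inE yS orbT.
    by have := LD y; rewrite mem_cat yL orbT inE yD orbT => /(_ isT).
  move=> y; rewrite mem_cat => /orP[yS|yD].
    have [|yL ty] := inS y; first by rewrite inE yS orbT.
    split; first by have := memL' y; rewrite -cat_cons !mem_cat memR yL.
    rewrite permM ty tpermD //; first by apply: contraNneq pS => ->.
    by apply: contraTneq yL => <-; have := freshD d (mem_head _ _); rewrite mem_cat negb_or => /andP[].
  split; first by rewrite -cat_cons mem_cat [in y \in d :: D]inE yD !orbT.
  have yFL : y \notin F ++ L by apply: freshD; rewrite inE yD orbT.
  rewrite permM (out_perm ont) ?inE // tpermD //; first by apply: contraNneq pD => ->.
  by apply: contraNneq dD => ->.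
- by apply: perm_onM; [apply: perm_on_sub ona | apply: perm_on_sub onD].
- apply: perm_onM; first exact: perm_on_sub ont.
  apply: perm_on_sub (tperm_on p d); apply/subsetP=> y.
  by move=> /set2P[]->; rewrite inE memL' ?pFL // mem_head orbT.
- rewrite mulgA -(mulgA t) (conjgC (tperm p d)) tpermJ tp td mulgA tt mul1g.
  exact: tperm2.
- rewrite mulgA -(mulgA a) -tD !mulgA prod -cR -!mulgA; congr (_ * _).
  by rewrite mulgA cyc_merge.
- move=> B cB aB tB.
  have subB : {subset F ++ L <= B}.
    (* B is stable under the new pair only. On F ++ L the new involution differs from t at p alone,
       and outside F ++ L both a and t are trivial; so B enlarged by all outside points is stable
       under the old pair. *)
    have st : {subset F ++ L <= B :|: ~: [set x in F ++ L]}.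
      apply: orb; first by rewrite inE cB.
        move=> v; rewrite !inE.
        have [vFL|vFL] := boolP (v \in F ++ L); last first.
          by rewrite (out_perm ona) ?inE // vFL orbT.
        by rewrite orbF -agree // => /aB->.
      move=> v; rewrite !inE.
      have [vFL|vFL] := boolP (v \in F ++ L); last first.
        by rewrite (out_perm ont) ?inE // vFL orbT.
      rewrite orbF => vB; have [vp|vp] := eqVneq v p; first by rewrite vp tp -vp vB.
      have tvp : p != t v by apply: contra_neq vp => E; apply: (@perm_inj _ t); rewrite tp.
      have tvd : d != t v.
        apply: contraTneq vFL => E; rewrite (_ : v = d) ?freshD ?mem_head //.
        by apply: (@perm_inj _ t); rewrite td.
      by have := tB v vB; rewrite permM tpermD // => ->.
    by move=> y yFL; have := st y yFL; rewrite !inE yFL orbF.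
  have dB : d \in B.
    by have := tB p (subB _ pFL); rewrite permM tp tpermL.
  have DB : {subset d :: D <= B}.
    apply: (cyc_stable UD (mem_head _ _) dB) => y yD yB.
    have := aB y yB; rewrite permM (out_perm ona) // inE; exact: freshD.
  by move=> y; rewrite memL' => /orP[/subB|/DB].
Qed.

(* x and y are consecutive in the cycle L, so multiplying by (x y) detaches x from L. *)
Lemma config_split tau c a t F L S x y :
    config tau c a t F L S -> x \in S -> y \in S -> x != y -> cyc L x = y ->
  exists R, perm_eq (x :: y :: R) L /\
    config tau c a (t * tperm x y) (rcons F x) (y :: R) [seq z <- S | z \notin [:: x; y]].
Proof.
move=> [UFL [US inS] ona ont tt prod ontau orb] xS yS xy Lx.
have [[xL tx] [yL ty]] := (inS x xS, inS y yS).
have UL : uniq L by move: UFL; rewrite cat_uniq => /and3P[].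
have [[|y' R] [cR pR UR]] := rot_head xL UL.
  by move: Lx xy; rewrite -cR cyc1 perm1 => ->; rewrite eqxx.
have yy' : y' = y by rewrite -Lx -cR cycE //= eqxx.
subst y'; exists R; split=> //.
have [xR yR] : x \notin R /\ y \notin R.
  by move: UR; rewrite /= inE negb_or => /andP[/andP[_ ->] /andP[->]].
have pFL : perm_eq (rcons F x ++ y :: R) (F ++ L).
  by rewrite cat_rcons perm_cat2l.
have memFL z : (z \in rcons F x ++ y :: R) = (z \in F ++ L) by apply: perm_mem.
have setFL : [set z in rcons F x ++ y :: R] = [set z in F ++ L].
  by apply/setP=> z; rewrite !inE memFL.
split.
- by rewrite (perm_uniq pFL).
- split; first exact: filter_uniq.
  move=> z; rewrite mem_filter !inE negb_or => /andP[/andP[zx zy] zS].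
  have [zL tz] := inS z zS; split.
    by move: zL; rewrite -(perm_mem pR) !inE (negPf zx).
  by rewrite permM tz tpermD // eq_sym.
- by rewrite setFL.
- rewrite setFL; apply: perm_onM => //; apply: perm_on_sub (tperm_on x y).
  by apply/subsetP=> z /set2P[]->; rewrite inE mem_cat ?xL ?yL orbT.
- rewrite mulgA -(mulgA t) (conjgC (tperm x y)) tpermJ tx ty mulgA tt mul1g.
  exact: tperm2.
- by rewrite mulgA prod -cR -mulgA cyc_cons // -mulgA tperm2 mulg1.
- apply: perm_on_sub ontau; apply/subsetP=> z.
  by rewrite !inE mem_rcons inE => ->; rewrite orbT.
- move=> B cB aB tB z; rewrite memFL; apply: orb => // v vB.
  have [E|vx] := eqVneq v x; first by rewrite E tx -E.
  have [E|vy] := eqVneq v y; first by rewrite E ty -E.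
  have := tB v vB; rewrite permM tpermD //.
    by apply: contra_neq vx => E; apply: (@perm_inj _ t); rewrite tx.
  by apply: contra_neq vy => E; apply: (@perm_inj _ t); rewrite ty.
Qed.

End Config.

Section Reach.
Variable T : finType.
Implicit Types (x y z p c : T) (D F L S X : seq T) (a t : {perm T}).

Section Head.
Variables (tau a0 : {perm T}) (c : T) (F0 L0 : seq T).

(* Some extension of the initial pair has #[a] = o, parity e, m points, s spare points
   and j points outside the long cycle L. *)
Definition reach (o : nat) (e : bool) (m s j : nat) :=
  exists a t F L S, [/\ config tau c a t F L S,
    [/\ #[a] = o, odd_perm a = e, size (F ++ L) = m, size S = s & size F = j],
    {in F0 ++ L0, a =1 a0}, {subset F0 <= F} & {subset L0 <= L}].

Lemma fresh_seq (s : seq T) d : uniq s -> size s + d <= #|T| ->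
  exists D, [/\ uniq D, size D = d & {in D, forall y, y \notin s}].
Proof.
move=> Us sd; exists (take d (enum [predC s])); split.
- by rewrite take_uniq ?enum_uniq.
- by rewrite size_takel // -cardE -(leq_add2l #|mem s|) cardC (card_uniqP Us).
- by move=> y /mem_take; rewrite mem_enum.
Qed.

(** Net effect on the spare points: d = 1 loses one, d = 2 keeps their number, and a larger d gains
    d - 2. The parity changes exactly when d is even. *)
Lemma reach_attach o e m s j d : reach o e m s.+1 j -> 0 < d -> m + d <= #|T| ->
  reach (lcmn o d) (e (+) ~~ odd d) (m + d) (s + d.-1) j.
Proof.
case=> a [t [F [L [S [cf [ao ae mE sE jE] aX XF L0L]]]]].
case: d => // d _ md; case: S sE cf => // p S [sE] cf.
have [D0 [UD dE fD]] : exists D, [/\ uniq D, size D = d.+1 & {in D, forall y, y \notin F ++ L}].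
  by apply: fresh_seq; [apply: config_uniq cf | rewrite mE].
case: D0 UD dE fD => // r D UD [dE] fD.
have [R [pR cf' oE pE agr]] := config_attach cf UD fD.
exists (a * cyc (r :: D)), (t * tperm p r), F, (p :: R ++ r :: D), (S ++ D).
split=> //.
- split=> //; first by rewrite oE ao dE.
  + by rewrite pE ae dE /= negbK.
  + by rewrite -cat_cons !size_cat (perm_size pR) addnA -size_cat mE /= dE.
  + by rewrite size_cat sE dE.
- move=> x xX; rewrite agr ?aX // mem_cat; move: xX; rewrite mem_cat.
  by case/orP=> [/XF->//|/L0L->]; rewrite orbT.
- by move=> x /L0L; rewrite -cat_cons mem_cat (perm_mem pR) => ->.
Qed.

(** This changes the length of the long cycle without changing the total number of points, when that
    length would not be coprime to the order of tau. Two consecutive points x, y of the new cycle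
    are spent on detaching x, so d - 3 of its d - 1 spare points remain. *)
Lemma reach_attach_split o e m s j d :
    reach o e m s.+1 j -> 2 < d -> m + d <= #|T| -> L0 = [::] ->
  reach (lcmn o d) (e (+) ~~ odd d) (m + d) (s + (d - 3)) j.+1.
Proof.
case=> a [t [F [L [S [cf [ao ae mE sE jE] aX XF L0L]]]]].
case: d => [|[|[|d]]] // _ md L00; case: S sE cf => // p S [sE] cf.
have [D0 [UD dE fD]] : exists D, [/\ uniq D, size D = d.+3 & {in D, forall y, y \notin F ++ L}].
  by apply: fresh_seq; [apply: config_uniq cf | rewrite mE].
case: D0 UD dE fD => [|r [|x [|y D]]] // UD [dE] fD.
have [R [pR cf' oE pE agr]] := config_attach cf UD fD.
have xy : x != y by case/and3P: UD => _; rewrite inE negb_or => /andP[].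
have UL' : uniq (p :: R ++ r :: x :: y :: D).
  by have := config_uniq cf'; rewrite cat_uniq => /and3P[].
have Lx : cyc (p :: R ++ r :: x :: y :: D) x = y.
  have E : p :: R ++ [:: r, x, y & D] = (p :: R ++ [:: r]) ++ [:: x, y & D].
    by rewrite /= -catA.
  rewrite E cyc_catC -?E // cycE //= ?eqxx //.
  by rewrite -[_ && _]/(uniq (([:: x, y & D]) ++ (p :: R ++ [:: r]))) uniq_catC -E.
have [||R' [pR' cf'']] := config_split cf' _ _ xy Lx.
- by rewrite mem_cat !inE eqxx orbT.
- by rewrite mem_cat !inE eqxx !orbT.
have US' := (config_spare cf').1.
exists (a * cyc [:: r, x, y & D]), (t * tperm p r * tperm x y), (rcons F x), (y :: R').
eexists; split; first exact: cf''.
- split=> //; first by rewrite oE ao /= dE.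
  + by rewrite pE ae /= dE !negbK.
  + rewrite cat_rcons size_cat (perm_size pR') -cat_cons !size_cat (perm_size pR).
    by rewrite addnA -size_cat mE /= dE.
  + have pS : perm_eq (S ++ [:: x, y & D]) ([:: x; y] ++ (S ++ D)).
      exact: (permEl (perm_catCA S [:: x; y] D)).
    have US : uniq ([:: x; y] ++ (S ++ D)) by rewrite -(perm_uniq pS).
    rewrite (perm_size (perm_filter _ pS)) filter_cat /= !inE !eqxx orbT /=.
    rewrite (_ : filter _ _ = S ++ D) ?size_cat ?sE ?dE ?subn0; first by lia.
    apply/all_filterP/allP=> z zSD; apply/negP=> zxy.
    by move: US; rewrite cat_uniq => /and3P[_ /hasPn/(_ z zSD)/negP].
  + by rewrite size_rcons jE.
- by move=> z xX; rewrite agr ?aX // mem_cat; move: xX; rewrite L00 cats0 => /XF->.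
- by move=> z /XF zF; rewrite mem_rcons inE zF orbT.
- by rewrite L00.
Qed.

Lemma reach_single o e m s j r : reach o e m (s + r) j -> m + r <= #|T| ->
  reach o e (m + r) s j.
Proof.
elim: r m => [|r IH] m; first by rewrite !addn0.
rewrite addnS => H mr; rewrite -addSnnS; apply: IH; last by lia.
have := reach_attach (d := 1) H isT; rewrite lcmn1 addbF addn0 addn1; apply; lia.
Qed.

Lemma reach_odd_cycles o e m s j d i : reach o e m s.+1 j -> odd d ->
  d.+2 %| o -> m + i * d.+2 <= #|T| -> reach o e (m + i * d.+2) (s + i * d).+1 j.
Proof.
move=> H od dvo; elim: i m s H => [|i IH] m s H mi; first by rewrite !addn0.
rewrite mulSn [(i.+1 * d)%N]mulSn !addnA; apply: IH; last by lia.
have := reach_attach (d := d.+2) H isT; rewrite /= !negbK od addbF.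
rewrite [s + d.+1]addnS (lcmn_idPl dvo); apply.
by apply: leq_trans mi; rewrite leq_add2l mulSn leq_addr.
Qed.

Lemma reach_transp_pairs o e m s j q : reach o e m s.+1 j -> 2 %| o ->
  m + 4 * q <= #|T| -> reach o e (m + 4 * q) s.+1 j.
Proof.
move=> H dvo; elim: q m H => [|q IH] m H mi; first by rewrite muln0 addn0.
have [m2 m4] : m + 2 <= #|T| /\ m + 2 + 2 <= #|T| by lia.
rewrite mulnS addnA; apply: IH; last by lia.
have := reach_attach (d := 2) H isT m2; rewrite /= (lcmn_idPl dvo) addn1 addbT => H'.
have := reach_attach (d := 2) H' isT m4.
by rewrite /= (lcmn_idPl dvo) addn1 addbT negbK -addnA.
Qed.

(** Pairs of 2-cycles advance by four points at no cost, so spare points are needed only for the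
    remainder modulo 4. *)
Lemma reach_fill o e m s j : reach o e m s.+1 j -> 2 %| o -> m <= #|T| ->
  (#|T| - m) %% 4 <= s.+1 -> exists s', reach o e #|T| s' j.
Proof.
move=> H dvo mT rs.
have TE : #|T| = (m + 4 * ((#|T| - m) %/ 4) + (#|T| - m) %% 4)%N.
  by have := divn_eq (#|T| - m) 4; lia.
exists (s.+1 - (#|T| - m) %% 4); rewrite {1}TE; apply: reach_single; last by rewrite -TE.
by rewrite subnK //; apply: reach_transp_pairs => //; lia.
Qed.

(** Once all points are used, L has [#|T| - j] points and is disjoint from tau, so [mem_cycle_mul]
    applies. The values of a on the initial points and the position of [F0] and [L0] are recorded
    because they supply the block argument for each initial configuration. *)
Lemma reach_full o e s j : reach o e #|T| s j -> coprime #[tau] (#|T| - j) ->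
  exists a t L, [/\ #[a] = o, odd_perm a = e, t * t = 1 & {in F0 ++ L0, a =1 a0}] /\
   [/\ a * t = tau * cyc L, uniq L, {subset L0 <= L}, {in F0, forall x, x \notin L} &
    [/\ tau \in <<[set a; t]>>, size L = (#|T| - j)%N & orbit_full c a t]].
Proof.
move=> [a [t [F [L [S [[UFL _ _ _ tt prod ontau orb] [ao ae mE _ jE] aX XF L0L]]]]]] cop.
have sL : size L = (#|T| - j)%N by move: mE; rewrite size_cat; lia.
have [UF FL UL] : [/\ uniq F, ~~ has (mem F) L & uniq L].
  by move: UFL; rewrite cat_uniq => /and3P[].
have F0L : {in F0, forall x, x \notin L}.
  by move=> x /XF xF; apply/negP=> /(hasPn FL); rewrite /= xF.
exists a, t, L; split; split=> //; split=> //.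
- have com : commute tau (cyc L).
    apply: perm_onC ontau (cyc_perm_on UL) _.
    rewrite disjoint_subset; apply/subsetP=> y; rewrite !inE => yF.
    by apply/negP=> /(hasPn FL); rewrite /= yF.
  have cL : cyc L ^+ size L = 1.
    case: L {UFL prod orb mE XF L0L sL FL F0L com} UL => [|x L] UL; first by rewrite expg0.
    by rewrite -(order_cyc UL) // expg_order.
  have : tau \in <[tau * cyc L]> by apply: mem_cycle_mul com cL _; rewrite sL.
  apply/subsetP; rewrite cycle_subG -prod.
  by rewrite groupM // mem_gen ?set21 ?set22.
- move=> B cB aB tB v; apply: (orb B) => //.
  have := UFL; move/card_uniqP; rewrite mE => E.
  have : mem (F ++ L) =i predT.
    by apply/subset_cardP; rewrite ?E ?cardT -?cardE //; apply/subsetP.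
  by move/(_ v).
Qed.

End Head.
End Reach.

(** * Initial configurations *)

Section Heads.
Variable T : finType.
Implicit Types (x : T) (R : seq T) (a t : {perm T}).

Definition large_pair (o : nat) (e : bool) :=
  exists a t : {perm T},
    [/\ #[a] = o, odd_perm a = e, t * t = 1 & Alt T \subset <<[set a; t]>>].

(* t = (x1 x3) *)
Definition odd_head x1 x2 R :=
  reach (tperm x1 x2) (cyc [:: x1, x2 & R]) x1 [:: x1; x2] [::].

(** Multiplying the cycle by (x1 x3) cuts it into (x1 x2) and the cycle on the other points; there
    only x3 is moved by t, so the points of R are spare. *)
Lemma reach_odd_head x1 x2 x3 R : let H := [:: x1, x2, x3 & R] in
  uniq H -> odd_head x1 x2 (x3 :: R) (size H) (~~ odd (size H)) (size H) (size R) 2.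
Proof.
move=> H UH; exists (cyc H), (tperm x1 x3), [:: x1; x2], (x3 :: R), R.
have /and4P[x1n x2n x3n UR0] := UH; have UR : uniq R := UR0.
have [x13 x1R] : x1 != x3 /\ x1 \notin R.
  by move: x1n; rewrite !inE !negb_or => /and3P[].
split=> //; last by split; rewrite ?order_cyc ?odd_cyc //= ?negbK.
split=> //.
- split=> // p pR; split; first by rewrite inE pR orbT.
  by rewrite tpermD //; [apply: contraNneq x1R => -> | apply: contraNneq x3n => ->].
- exact: cyc_perm_on.
- apply: perm_on_sub (tperm_on x1 x3).
  by apply/subsetP=> y /set2P[]->; rewrite !inE eqxx ?orbT.
- exact: tperm2.
- rewrite /H -[x1 :: _]/(x1 :: [:: x2] ++ x3 :: R) -(cyc_merge _ x1R x3n) cyc2.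
  by rewrite -mulgA tperm2 mulg1.
- apply: perm_on_sub (tperm_on x1 x2).
  by apply/subsetP=> y /set2P[]->; rewrite !inE eqxx ?orbT.
- move=> B xB aB _; apply: (cyc_stable UH (mem_head _ _) xB) => y _; exact: aB.
Qed.

(** Since a sends x1 to x2 and t fixes x2, the transposition tau = (x1 x2) alone satisfies all
    hypotheses of [tperm_full]. *)
Lemma odd_head_large x1 x2 R o e s j : uniq [:: x1, x2 & R] ->
  odd_head x1 x2 R o e #|T| s j -> odd (#|T| - j) -> large_pair o e.
Proof.
move=> UR rch oT.
have /andP[x12 _] := UR; have {}x12 : x1 != x2 by move: x12; rewrite inE negb_or => /andP[].
have o2 : #[tperm x1 x2] = 2.
  by rewrite -cyc2 order_cyc //= inE x12.
have [|a [t [L [[ao ae tt aE] [prod UL _ F0L [tauG sL orb]]]]]] := reach_full rch.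
  by rewrite o2 coprime2n.
exists a, t; split=> //.
have [aG tG] : a \in <<[set a; t]>> /\ t \in <<[set a; t]>>.
  by rewrite !mem_gen ?set21 ?set22.
have ax : a x1 = x2.
  by rewrite aE ?mem_head // cycE //= eqxx.
have tx : t x2 = x2.
  have := congr1 (fun f : {perm T} => f x1) prod.
  by rewrite !permM ax tpermL cyc_id // F0L // !inE eqxx orbT.
rewrite (@tperm_full _ <<[set a; t]>>%G a t x1 x1 x2) ?subsetT ?ax ?tx //.
by rewrite tperm1 group1.
Qed.

(* t = (x1 x4) (x2 x3) *)
Definition even_head x1 x2 x3 x4 x5 R :=
  reach (tperm x3 x1) (cyc [:: x1, x2, x3, x4, x5 & R]) x1 [:: x3; x1; x2] [:: x4; x5].

(** For even [#|T|] a long cycle missing only the two points of tau would have even length. The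
    additional factor (x2 x3) of t makes x2 a fixed point of [a * t], which shortens L by one. *)
Lemma reach_even_head x1 x2 x3 x4 x5 R : let H := [:: x1, x2, x3, x4, x5 & R] in
  uniq H ->
  even_head x1 x2 x3 x4 x5 R (size H) (~~ odd (size H)) (size H) (size R).+1 3.
Proof.
move=> H UH.
exists (cyc H), (tperm x1 x4 * tperm x2 x3), [:: x3; x1; x2], [:: x4, x5 & R], (x5 :: R).
have pH : perm_eq [:: x3, x1, x2, x4, x5 & R] H.
  change (perm_eq ([:: x3; x1; x2] ++ [:: x4, x5 & R]) ([:: x1; x2; x3] ++ [:: x4, x5 & R])).
  rewrite perm_cat2r.
  exact: (permEl (perm_rot 2 [:: x1; x2; x3])).
have UF := UH; rewrite -(perm_uniq pH) in UF.
have memH x : (x \in [:: x3, x1, x2, x4, x5 & R]) = (x \in H) by apply: perm_mem.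
have UR : uniq [:: x4, x5 & R] by case/and4P: UH.
have x4R : x4 \notin x5 :: R by case/andP: UR.
have notR y : y \in [:: x1; x2; x3] -> y \notin [:: x4, x5 & R].
  move=> yF; apply/negP=> yR; have := UH.
  rewrite -[H]/([:: x1; x2; x3] ++ [:: x4, x5 & R]) cat_uniq.
  by case/and3P=> _ /hasPn/(_ y yR); rewrite /= yF.
have [x1R x2R x3R] : [/\ x1 \notin [:: x4, x5 & R], x2 \notin [:: x4, x5 & R] & x3 \notin [:: x4, x5 & R]].
  by rewrite !notR // !inE eqxx ?orbT.
have U3 : uniq [:: x1; x2; x3].
  by move: UH; rewrite -[H]/([:: x1; x2; x3] ++ [:: x4, x5 & R]) cat_uniq => /andP[].
have ne y z : y \notin [:: x4, x5 & R] -> z \in [:: x4, x5 & R] -> y != z.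
  by move=> yR zR; apply: contraNneq yR => ->.
have x4i : x4 \in [:: x4, x5 & R] by rewrite mem_head.
have [x21 x31] : x2 != x1 /\ x3 != x1.
  by move: U3; rewrite /= !inE negb_or ![_ == x1]eq_sym => /and3P[/andP[]].
have com : commute (tperm x1 x4) (tperm x2 x3).
  by rewrite /commute conjgC tpermJ !tpermD // ne.
split=> //; last first.
- by move=> y; rewrite !inE => /orP[]->; rewrite ?orbT.
- by split; rewrite ?order_cyc ?odd_cyc //= ?negbK.
split=> //.
- split=> [|p pR]; first by case/andP: UR.
  have pi : p \in [:: x4, x5 & R] by rewrite inE pR orbT.
  have p4 : x4 != p by apply: contraNneq x4R => ->.
  by rewrite permM !tpermD // ne.
- rewrite -[_ ++ _]/[:: x3, x1, x2, x4, x5 & R].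
  apply: perm_on_sub (cyc_perm_on UH); apply/subsetP=> y; rewrite !in_set.
  by rewrite memH.
- apply: perm_onM; [apply: perm_on_sub (tperm_on x1 x4)|apply: perm_on_sub (tperm_on x2 x3)];
  by apply/subsetP=> y /set2P[]->; rewrite !inE eqxx ?orbT.
- by rewrite -mulgA com !mulgA -(mulgA (tperm x1 x4)) tperm2 mulg1 tperm2.
- have x14 : x1 \notin x5 :: R by move: x1R; rewrite inE negb_or => /andP[].
  have -> : cyc H = cyc [:: x1; x2; x3] * cyc [:: x4, x5 & R] * tperm x1 x4.
    by rewrite (cyc_merge _ x14 x4R).
  have com2 : commute (cyc [:: x4, x5 & R]) (tperm x2 x3).
    apply: perm_onC (cyc_perm_on UR) (tperm_on x2 x3) _.
    rewrite disjoint_subset; apply/subsetP=> y; rewrite !in_set => yR.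
    by apply/negP=> /set2P[] yE; move: yR; rewrite yE ?(negPf x2R) ?(negPf x3R).
  rewrite -mulgA (mulgA (tperm x1 x4)) tperm2 mul1g -mulgA com2 mulgA.
  by rewrite -(cyc3_rot U3) cyc_cons ?inE // -(mulgA (cyc _)) tperm2 mulg1 cyc2.
- apply: perm_on_sub (tperm_on x3 x1).
  by apply/subsetP=> y /set2P[]->; rewrite !inE eqxx ?orbT.
- move=> B xB aB _ y; rewrite -[_ ++ _]/[:: x3, x1, x2, x4, x5 & R] memH.
  by apply: (cyc_stable UH (mem_head _ _) xB) => v _; apply: aB.
Qed.

(** Conjugation by a carries tau to (x2 x4), and conjugation by [a * t] then gives (x2 y) for all y
    in L. Hence all transpositions of points of L are available, and x4, [a x4] = x5 and [t x5] lie
    in L. *)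
Lemma even_head_large x1 x2 x3 x4 x5 R o e s : uniq [:: x1, x2, x3, x4, x5 & R] ->
  even_head x1 x2 x3 x4 x5 R o e #|T| s 3 -> ~~ odd #|T| -> large_pair o e.
Proof.
move=> UH rch eT.
have [x1n x2n x3n x4n] : [/\ x1 \notin [:: x2, x3, x4, x5 & R],
    x2 \notin [:: x3, x4, x5 & R], x3 \notin [:: x4, x5 & R] & x4 \notin x5 :: R].
  by have /and5P[-> -> -> -> _] := UH.
have [x31 x21 x32] : [/\ x3 != x1, x2 != x1 & x3 != x2].
  split; first by apply: contraNneq x1n => ->; rewrite !inE eqxx orbT.
    by apply: contraNneq x1n => ->; rewrite mem_head.
  by apply: contraNneq x2n => ->; rewrite mem_head.
have T3 : 2 < #|T|.
  by rewrite (cardD1 x1) (cardD1 x2) (cardD1 x3) !inE x31 x21 x32.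
have o2 : #[tperm x3 x1] = 2.
  by rewrite -cyc2 order_cyc //= inE x31.
have [|a [t [L [[ao ae tt aE] [prod UL L0L F0L [tauG sL orb]]]]]] := reach_full rch.
  by rewrite o2 coprime2n oddB // (negPf eT).
exists a, t; split=> //; set G := <<[set a; t]>>%G.
have [aG tG] : a \in G /\ t \in G by rewrite !mem_gen ?set21 ?set22.
have a1 : a x1 = x2 by rewrite aE ?inE ?eqxx ?orbT // cycE //= eqxx.
have a3 : a x3 = x4.
  by rewrite aE ?inE ?eqxx ?orbT // cycE //= (negPf x31) (negPf x32) eqxx.
have a4 : a x4 = x5.
  rewrite aE ?inE ?eqxx ?orbT // cycE //=.
  have [/negPf-> /negPf-> /negPf->] : [/\ x4 != x1, x4 != x2 & x4 != x3]; last by rewrite eqxx.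
  split; first by apply: contraNneq x1n => <-; rewrite !inE eqxx !orbT.
    by apply: contraNneq x2n => <-; rewrite !inE eqxx !orbT.
  by apply: contraNneq x3n => <-; rewrite !inE eqxx.
(* a maps the pair x1, x3 to x2, x4, and a * t fixes x2 while it cycles through L. *)
have G24 : tperm x2 x4 \in G by rewrite -a1 -a3 tpermC -tpermJ groupJ.
have zG : a * t \in G by rewrite groupM.
have tau1 y : y \in L -> tperm x3 x1 y = y.
  by move=> yL; rewrite tpermD //; apply: contraTneq yL => <-; rewrite F0L // !inE eqxx ?orbT.
have zL : {in L, forall y, (a * t) y = cyc L y}.
  by move=> y yL; rewrite prod permM tau1.
have z2 : (a * t) x2 = x2.
  by rewrite prod permM tpermD ?(eq_sym x1) // cyc_id // F0L // !inE eqxx !orbT.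
have [x4L x5L] : x4 \in L /\ x5 \in L by rewrite !L0L // !inE eqxx ?orbT.
have G2L : {in L, forall y, tperm x2 y \in G}.
  have st : {subset L <= [set y | tperm x2 y \in G]}.
    apply: (cyc_stable UL x4L); first by rewrite inE.
    move=> y yL; rewrite !inE => yG.
    by rewrite -zL // -{1}z2 -tpermJ groupJ.
  by move=> y /st; rewrite inE.
have GL y z : y \in L -> z \in L -> tperm y z \in G.
  by move=> /G2L yG /G2L zG'; apply: tperm_trans zG'; rewrite tpermC.
rewrite (@tperm_full _ G a t x1 x4 x5) ?subsetT ?a4 ?GL //.
have -> : t x5 = (a * t) x4 by rewrite permM a4.
by rewrite zL // mem_cyc.
Qed.

End Heads.

(** * Pairs for the generic values of k and n *)

Section Families.
Variable T : finType.
Implicit Types (x : T) (R : seq T) (a t : {perm T}).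

(* t = (x3 x4) (x1 x5); for order 3 no transposition is available, hence this 3-cycle. *)
Definition triple_head x1 x2 x3 x4 x5 x6 :=
  reach (cyc [:: x1; x2; x4]) (cyc [:: x1; x2; x3] * cyc [:: x4; x5; x6]) x1 [:: x1; x2; x4] [::].

(** The factor (x3 x4) joins the two 3-cycles into a 6-cycle, and (x1 x5) cuts it into (x1 x2 x4)
    and (x5 x6 x3). In the latter only x6 is fixed by t. *)
Lemma reach_triple_head x1 x2 x3 x4 x5 x6 : uniq [:: x1; x2; x3; x4; x5; x6] ->
  triple_head x1 x2 x3 x4 x5 x6 3 false 6 1 3.
Proof.
move=> U; exists (cyc [:: x1; x2; x3] * cyc [:: x4; x5; x6]), (tperm x3 x4 * tperm x1 x5).
exists [:: x1; x2; x4], [:: x5; x6; x3], [:: x6].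
have pH : perm_eq ([:: x1; x2; x4] ++ [:: x5; x6; x3]) ([:: x1; x2; x3] ++ [:: x4; x5; x6]).
  change (perm_eq ([:: x1; x2] ++ [:: x4; x5; x6; x3]) ([:: x1; x2] ++ [:: x3; x4; x5; x6])).
  by rewrite perm_cat2l; exact: (permEl (perm_rot 1 [:: x3; x4; x5; x6])).
have [U1 U2 U12] : [/\ uniq [:: x1; x2; x3], uniq [:: x4; x5; x6] & [disjoint [set x in [:: x1; x2; x3]] & [set x in [:: x4; x5; x6]]]].
  have := U; rewrite -[_ :: _]/([:: x1; x2; x3] ++ [:: x4; x5; x6]) cat_uniq => /and3P[-> H ->].
  split=> //; rewrite disjoint_sym disjoint_subset; apply/subsetP=> y; rewrite in_set => yR.
  by have /hasPn/(_ y yR) := H; rewrite /= !inE.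
have onK : perm_on [set x in [:: x1; x2; x3] ++ [:: x4; x5; x6]] (cyc [:: x1; x2; x3] * cyc [:: x4; x5; x6]).
  apply: perm_onM; [apply: perm_on_sub (cyc_perm_on U1)|apply: perm_on_sub (cyc_perm_on U2)];
  by apply/subsetP=> y; rewrite !in_set mem_cat => ->; rewrite ?orbT.
have memH x : (x \in [:: x1; x2; x4] ++ [:: x5; x6; x3]) = (x \in [:: x1; x2; x3] ++ [:: x4; x5; x6]) by apply: perm_mem.
split=> //; last first.
  split=> //.
    rewrite (order_mul_disjoint (cyc_perm_on U1) (cyc_perm_on U2) U12).
    by rewrite !order_cyc.
  by rewrite odd_permM !odd_cyc.
have [[x12 x13 x14 x15 x16] [x23 x24 x25 x26]] :
    [/\ x1 != x2, x1 != x3, x1 != x4, x1 != x5 & x1 != x6] /\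
    [/\ x2 != x3, x2 != x4, x2 != x5 & x2 != x6].
  by move: U; rewrite /= !inE !negb_or => /andP[/and5P[-> -> -> -> ->] /andP[/and4P[-> -> -> ->]]].
have [[x34 x35 x36] [x45 x46 x56]] :
    [/\ x3 != x4, x3 != x5 & x3 != x6] /\ [/\ x4 != x5, x4 != x6 & x5 != x6].
  by move: U; rewrite /= !inE !negb_or => /and5P[_ _ /and3P[-> -> ->] /andP[-> ->] /andP[->]].
have com : commute (tperm x3 x4) (tperm x1 x5).
  by rewrite /commute conjgC tpermJ !tpermD // eq_sym.
split=> //.
- by rewrite (perm_uniq pH).
- split=> // p; rewrite !inE => /eqP->; rewrite eqxx orbT; split=> //.
  by rewrite permM !tpermD.
- apply: perm_on_sub onK; apply/subsetP=> y; rewrite !in_set; by rewrite memH.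
- apply: perm_onM; [apply: perm_on_sub (tperm_on x3 x4)|apply: perm_on_sub (tperm_on x1 x5)];
  by apply/subsetP=> y /set2P[]->; rewrite !inE eqxx ?orbT.
- by rewrite -mulgA com !mulgA -(mulgA (tperm x3 x4)) tperm2 mulg1 tperm2.
- rewrite [cyc [:: x1; x2; x3]](cyc3_rot (x := x3)) ?(uniq3_rot (uniq3_rot U1)) //.
  rewrite mulgA (@cyc_merge _ x3 x4 [:: x1; x2] [:: x5; x6]); first last.
  + by rewrite !inE negb_or x45.
  + by rewrite !inE negb_or x35.
  have U6 : uniq [:: x3; x1; x2; x4; x5; x6].
    rewrite -[_ :: _]/([:: x3; x1; x2] ++ [:: x4; x5; x6]) (perm_uniq (s2 := [:: x1; x2; x3] ++ [:: x4; x5; x6])) //.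
    by rewrite perm_cat2r; exact: (permEl (perm_rot 2 [:: x1; x2; x3])).
  have -> : cyc (x3 :: [:: x1; x2] ++ x4 :: [:: x5; x6]) = cyc (x1 :: [:: x2; x4] ++ x5 :: [:: x6; x3]).
    exact: esym (cyc_rot 1 U6).
  rewrite -cyc_merge.
  + by rewrite -mulgA tperm2 mulg1.
  + by rewrite !inE negb_or x16.
  + by rewrite !inE negb_or x56 eq_sym.
- have U4 : uniq [:: x1; x2; x4] by rewrite /= !inE negb_or x12 x14 x24.
  exact: cyc_perm_on.
- move=> B x1B aB tB.
  have K1 : {subset [:: x1; x2; x3] <= B}.
    apply: (cyc_stable U1 (mem_head _ _) x1B) => y yK /aB.
    rewrite permM (cyc_id U2) //; have := mem_cyc y U1; rewrite yK => yK'.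
    by apply: contraTN yK' => yK'; have := disjointFl U12; move/(_ (cyc [:: x1; x2; x3] y)); rewrite !in_set yK' => /(_ isT)->.
  have x4B : x4 \in B.
    have tx3 : (tperm x3 x4 * tperm x1 x5) x3 = x4 by rewrite permM tpermL tpermD // eq_sym.
    by rewrite -tx3; apply/tB/K1; rewrite !inE eqxx !orbT.
  have K2 : {subset [:: x4; x5; x6] <= B}.
    apply: (cyc_stable U2 (mem_head _ _) x4B) => y yK /aB.
    rewrite permM (@cyc_id _ _ y U1) //; apply/negP=> yK'.
    by have := disjointFl U12; move/(_ y); rewrite !in_set yK yK' => /(_ isT).
  by move=> y; rewrite memH mem_cat => /orP[/K1|/K2].
Qed.

Lemma triple_head_large x1 x2 x3 x4 x5 x6 e s j : uniq [:: x1; x2; x3; x4; x5; x6] ->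
    triple_head x1 x2 x3 x4 x5 x6 3 e #|T| s j -> coprime 3 (#|T| - j) ->
  large_pair T 3 e.
Proof.
move=> U rch cop.
have U3 : uniq [:: x1; x2; x4].
  by move: U; rewrite /= !inE !negb_or => /and3P[/and5P[-> _ -> _ _] /and4P[_ -> _ _] _].
have U1 : uniq [:: x1; x2; x3].
  by move: U; rewrite /= !inE !negb_or => /and3P[/and5P[-> -> _ _ _] /and4P[-> _ _ _] _].
have [U2 x2n] : uniq [:: x4; x5; x6] /\ x2 \notin [:: x4; x5; x6].
  split; last by case/and3P: U => _ + _; rewrite !inE !negb_or => /and4P[_ -> -> ->].
  by case/and4P: U.
have o3 : #[cyc [:: x1; x2; x4]] = 3 by rewrite order_cyc.
have [|a [t [L [[ao ae tt aE] [prod UL _ F0L [tauG sL orb]]]]]] := reach_full rch.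
  by rewrite o3.
exists a, t; split=> //; set G := <<[set a; t]>>%G.
have [aG tG] : a \in G /\ t \in G by rewrite !mem_gen ?set21 ?set22.
have c1 : cyc [:: x1; x2; x4] x1 = x2 by rewrite cycE //= eqxx.
have a1 : a x1 = x2.
  have c1' : cyc [:: x1; x2; x3] x1 = x2 by rewrite cycE //= eqxx.
  by rewrite aE ?mem_head // permM c1' cyc_id.
have t2 : t x2 = x2.
  have := congr1 (fun f : {perm T} => f x1) prod.
  by rewrite !permM a1 c1 cyc_id // F0L // !inE eqxx orbT.
have r12 : cyc3_rel G x1 x2.
  by apply/orP; right; apply/existsP; exists x4; rewrite U3.
by apply: (cyc3_orbit_full aG tG orb r12); rewrite ?a1 ?t2 // /cyc3_rel eqxx.
Qed.

(** This hides the parity of [#|T|]: the configuration for even [#|T|] has one spare point fewer.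
    What remains for each k is to count spare points. *)
Definition large_head h := exists tau a0 c (F0 L0 : seq T) j,
  reach tau a0 c F0 L0 h (~~ odd h) h (h - 3 - ~~ odd #|T|) j /\
  forall o e s, reach tau a0 c F0 L0 o e #|T| s j -> large_pair T o e.

Lemma large_headP h : 4 < h <= #|T| -> large_head h.
Proof.
case/andP=> h5 hT.
have [H UH Hh] : exists2 H : seq T, uniq H & size H = h.
  by exists (take h (enum T)); rewrite ?take_uniq ?enum_uniq // size_takel -?cardE.
case: H UH Hh => [|x1 [|x2 [|x3 [|x4 [|x5 R]]]]] UH Hh; try by rewrite -Hh in h5.
have [oT|eT] := boolP (odd #|T|).
  have rch := reach_odd_head UH.
  exists (tperm x1 x2), (cyc [:: x1, x2, x3, x4, x5 & R]), x1, [:: x1; x2], [::], 2; split.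
    by rewrite oT subn0 -Hh; exact: rch.
  move=> o e s rch'; apply: odd_head_large UH rch' _.
  by rewrite oddB ?oT //; lia.
have rch := reach_even_head UH.
exists (tperm x3 x1), (cyc [:: x1, x2, x3, x4, x5 & R]), x1, [:: x3; x1; x2], [:: x4; x5], 3; split.
  by rewrite eT -Hh; exact: rch.
by move=> o e s rch'; apply: even_head_large UH rch' eT.
Qed.

(** In the first range [#|T| - k] fixed points fit on one k-cycle; an even [#|T|] is then at most 2k
    - 4, which matches the lost spare point. With two or more k-cycles there are at least 2k - 6
    spare points, and k >= 5 makes this enough for any remainder below k. *)
Lemma large_odd k : odd k -> 4 < k <= #|T| ->
  (#|T| <= k.*2 - 3) || (k.*2 <= #|T|) -> large_pair T k false.
Proof.
move=> ok hk; have /andP[k5 kT] := hk.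
have [tau [a0 [c [F0 [L0 [j [rch lg]]]]]]] := large_headP hk.
rewrite ok in rch.
have [i iE] : exists i, i = (#|T| %/ k).-1 by exists (#|T| %/ k).-1.
have [r rE] : exists r, r = #|T| %% k by exists (#|T| %% k).
case/orP=> [small|big].
  apply: (lg _ _ (k - 3 - ~~ odd #|T| - (#|T| - k))).
  have nE : #|T| = (k + (#|T| - k))%N by lia.
  rewrite [X in reach _ _ _ _ _ _ _ X]nE; apply: reach_single; last by lia.
  by rewrite (_ : (_ - _ + _)%N = k - 3 - ~~ odd #|T|) //; lia.
have TE : #|T| = (k + i * k + r)%N.
  rewrite {1}(divn_eq #|T| k) -rE iE; congr (_ + _).
  by rewrite -mulSn prednK // divn_gt0; lia.
have i1 : 0 < i by rewrite iE -ltnS prednK ?divn_gt0 ?leq_divRL; lia.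
have rk : r < k by rewrite rE ltn_mod; lia.
apply: (lg _ _ (((k - 3 - ~~ odd #|T|).-1 + i * (k - 2)).+1 - r)%N).
rewrite [X in reach _ _ _ _ _ _ _ X]TE; apply: reach_single; last by lia.
have ik : k - 2 <= i * (k - 2) by rewrite leq_pmull.
rewrite subnK; last by lia.
have kE : k = (k - 2).+2 by lia.
have := @reach_odd_cycles _ _ _ _ _ _ k false k ((k - 3 - ~~ odd #|T|).-1) j (k - 2) i.
rewrite -!kE prednK; last by lia.
by apply=> //; rewrite ?oddB //; lia.
Qed.

(** As k is even, the remainder of [#|T| - k] modulo 4 is at most 2 for even [#|T|] and at most 3
    for odd [#|T|]; the k - 4 or k - 3 spare points suffice from k = 6 on. *)
Lemma large_even_true k : ~~ odd k -> 5 < k <= #|T| -> large_pair T k true.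
Proof.
move=> ek /andP[k5 kT].
have [|tau [a0 [c [F0 [L0 [j [rch lg]]]]]]] := @large_headP k; first by lia.
rewrite ek in rch.
have [s sE] : exists s, k - 3 - ~~ odd #|T| = s.+1 by exists (k - 3 - ~~ odd #|T|).-1; lia.
rewrite sE in rch.
have [|//||s' rch'] := reach_fill rch; [by rewrite dvdn2 | | exact: lg rch'].
by rewrite -sE; lia.
Qed.

Lemma large_even_false k : ~~ odd k -> 5 < k -> k + 2 <= #|T| -> large_pair T k false.
Proof.
move=> ek k5 kT.
have [|tau [a0 [c [F0 [L0 [j [rch lg]]]]]]] := @large_headP k; first by lia.
rewrite ek in rch.
have [s sE] : exists s, k - 3 - ~~ odd #|T| = s.+1 by exists (k - 3 - ~~ odd #|T|).-1; lia.
rewrite sE in rch; have k2 : 2 %| k by rewrite dvdn2.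
(* One 2-cycle makes the odd k-cycle even without changing the order or the number of spare
   points. *)
have := reach_attach (d := 2) rch isT kT; rewrite /= (lcmn_idPl k2) addn1 => {}rch.
have [//|//||s' rch'] := reach_fill rch; last exact: lg rch'.
by rewrite -sE; lia.
Qed.

(** Here a is a b-cycle with two 2-cycles, hence even of order 2b. The remaining b - 4 or b - 3
    points are fixed by a and use up the spare points exactly. *)
Lemma large_double_false b : odd b -> 4 < b -> b.*2 <= #|T| <= b.*2.+1 ->
  large_pair T b.*2 false.
Proof.
move=> ob b4 /andP[bT Tb].
have [|tau [a0 [c [F0 [L0 [j [rch lg]]]]]]] := @large_headP b; first by lia.
rewrite ob in rch.
have [s sE] : exists s, b - 3 - ~~ odd #|T| = s.+1 by exists (b - 3 - ~~ odd #|T|).-1; lia.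
rewrite sE in rch.
have [m2 m4] : b + 2 <= #|T| /\ b + 2 + 2 <= #|T| by lia.
have lcm2 : lcmn b 2 = b.*2.
  by rewrite -muln2 -muln_lcm_gcd; have /eqP-> : coprime b 2; rewrite ?muln1 // coprimen2.
have lcm4 : lcmn b.*2 2 = b.*2 by apply/lcmn_idPl; rewrite -muln2 dvdn_mull.
have := reach_attach (d := 2) rch isT m2; rewrite /= lcm2 addn1 => rch2.
have := reach_attach (d := 2) rch2 isT m4; rewrite /= lcm4 addn1 => rch4.
have TE : #|T| = (b + 2 + 2 + s.+1)%N by lia.
apply: (lg _ _ 0); rewrite [X in reach _ _ _ _ _ _ _ X]TE.
by apply: reach_single => //; rewrite -TE.
Qed.

(** Here a contains a 2b-cycle and a cycle of length q = 2 ^ (r + 2): both are odd, so together they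
    are even, of order qb. They fit because qb - q - 2b = (q - 2)(b - 1) - 2 is positive. *)
Lemma large_mul4_false r b : odd b -> 2 < b -> 2 ^ r.+2 * b <= #|T| ->
  large_pair T (2 ^ r.+2 * b)%N false.
Proof.
move=> ob b4 bT.
have p4 : 4 <= 2 ^ r.+2 by rewrite (leq_pexp2l (m := 2) (n1 := 2)).
have mT : b.*2 + 2 ^ r.+2 <= 2 ^ r.+2 * b by nia.
have [|tau [a0 [c [F0 [L0 [j [rch lg]]]]]]] := @large_headP b.*2; first by lia.
rewrite odd_double in rch.
have [s sE] : exists s, b.*2 - 3 - ~~ odd #|T| = s.+1.
  by exists (b.*2 - 3 - ~~ odd #|T|).-1; lia.
rewrite sE in rch.
have lcmE : lcmn b.*2 (2 ^ r.+2) = (2 ^ r.+2 * b)%N.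
  rewrite [(2 ^ r.+2)%N]expnS -mul2n -muln_lcmr -mulnA; congr (_ * _)%N.
  have /eqP g1 : coprime b (2 ^ r.+1) by rewrite coprimeXr // coprimen2.
  by rewrite mulnC -muln_lcm_gcd g1 muln1.
have m2 : b.*2 + 2 ^ r.+2 <= #|T| by lia.
have := reach_attach rch _ m2; rewrite lcmE oddX /= expn_gt0 => /(_ isT) {}rch.
have sE' : s + (2 ^ r.+2).-1 = (s + (2 ^ r.+2).-2).+1 by lia.
rewrite sE' in rch.
have [|//||s' rch'] := reach_fill rch; last exact: lg rch'.
- by rewrite dvdn_mulr // dvdn_exp.
- by have := ltn_pmod (#|T| - (b.*2 + 2 ^ r.+2)) (isT : 0 < 4); lia.
Qed.

(** A 4-cycle is too short for [even_head], so even [#|T|] starts from two 4-cycles with one point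
    split off. Either start has a single spare point; further 4-cycles and 2-cycles each flip the
    parity, and they are chosen so that the remainder modulo 4 is at most 1. The excluded degrees
    are too small for the chosen cycles. *)
Lemma large4 e : 4 < #|T| ->
    (if e then #|T| \notin [:: 6; 7; 8] else #|T| \notin [:: 5; 6; 10]) ->
  large_pair T 4 e.
Proof.
move=> T4 Te.
have [H UH Hh] : exists2 H : seq T, uniq H & size H = 4.
  by exists (take 4 (enum T)); rewrite ?take_uniq ?enum_uniq // size_takel -?cardE 1?ltnW.
case: H UH Hh => [|x1 [|x2 [|x3 [|x4 [|x5 R]]]]] // UH _.
have rch := reach_odd_head UH; rewrite /= in rch.
have lg o e' s j := @odd_head_large T x1 x2 [:: x3; x4] o e' s j UH.
have fin m s j : odd (#|T| - j) -> m <= #|T| -> (#|T| - m) %% 4 <= s.+1 ->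
    odd_head x1 x2 [:: x3; x4] 4 e m s.+1 j -> large_pair T 4 e.
  move=> oj mT ms H; have [//|//|//|s' H'] := reach_fill H.
  exact: lg H' oj.
have r4 e' m s j : odd_head x1 x2 [:: x3; x4] 4 e' m s.+1 j -> m + 4 <= #|T| ->
    odd_head x1 x2 [:: x3; x4] 4 (~~ e') (m + 4) (s + 3) j.
  by move=> H mT; have := reach_attach (d := 4) H isT mT; rewrite addbT.
have r2 e' m s j : odd_head x1 x2 [:: x3; x4] 4 e' m s.+1 j -> m + 2 <= #|T| ->
    odd_head x1 x2 [:: x3; x4] 4 (~~ e') (m + 2) (s + 1) j.
  by move=> H mT; have := reach_attach (d := 2) H isT mT; rewrite addbT.
have sp : 8 <= #|T| -> odd_head x1 x2 [:: x3; x4] 4 false 8 1 3.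
  by move=> T8; have := reach_attach_split (d := 4) rch isT T8 erefl.
case: (boolP (odd #|T|)) => oT.
  have jT : odd (#|T| - 2) by lia.
  have [T1|T3] : (#|T| %% 4 = 1)%N \/ (#|T| %% 4 = 3)%N by lia.
    case: e Te fin => Te fin.
      by apply: (fin 4 0 2) => //; lia.
    have T9 : 4 + 4 <= #|T| by move: Te; rewrite !inE; lia.
    by apply: (fin _ _ _ jT T9 _ (r4 _ _ _ _ rch T9)); lia.
  case: e Te fin => Te fin.
    have [T8 T10] : 4 + 4 <= #|T| /\ 4 + 4 + 2 <= #|T| by move: Te; rewrite !inE; lia.
    by apply: (fin _ _ _ jT T10 _ (r2 _ _ _ _ (r4 _ _ _ _ rch T8) T10)); lia.
  have T6 : 4 + 2 <= #|T| by lia.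
  by apply: (fin _ _ _ jT T6 _ (r2 _ _ _ _ rch T6)); lia.
have jT : odd (#|T| - 3) by lia.
have T8 : 8 <= #|T| by case: e Te {fin}; rewrite !inE; lia.
have {}rch := sp T8.
have [T0|T2] : (#|T| %% 4 = 0)%N \/ (#|T| %% 4 = 2)%N by lia.
  case: e Te fin => Te fin.
    have T12 : 8 + 4 <= #|T| by move: Te; rewrite !inE; lia.
    by apply: (fin _ _ _ jT T12 _ (r4 _ _ _ _ rch T12)); lia.
  by apply: (fin _ _ _ jT T8 _ rch); lia.
case: e Te fin => Te fin.
  have T10 : 8 + 2 <= #|T| by lia.
  by apply: (fin _ _ _ jT T10 _ (r2 _ _ _ _ rch T10)); lia.
have [T12 T14] : 8 + 4 <= #|T| /\ 8 + 4 + 2 <= #|T| by move: Te; rewrite !inE; lia.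
by apply: (fin _ _ _ jT T14 _ (r2 _ _ _ _ (r4 _ _ _ _ rch T12) T14)); lia.
Qed.

(** The long cycle has [#|T| - 3] points, which is prime to 3 unless 3 divides [#|T|]; in that case
    the last 3-cycle is attached with a point split off. Each ordinary 3-cycle gains one spare
    point. Degree 8 fails because six points leave one spare point for two fixed points. *)
Lemma large3 : 6 < #|T| -> #|T| != 8 -> large_pair T 3 false.
Proof.
move=> T6 T8.
have [H UH Hh] : exists2 H : seq T, uniq H & size H = 6.
  by exists (take 6 (enum T)); rewrite ?take_uniq ?enum_uniq // size_takel -?cardE 1?ltnW.
case: H UH Hh => [|x1 [|x2 [|x3 [|x4 [|x5 [|x6 [|x7 R]]]]]]] // UH _.
have rch := reach_triple_head UH.
have cop m : m %% 3 != 0 -> coprime 3 m by rewrite prime_coprime.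
have [T0|T0] := eqVneq (#|T| %% 3) 0.
  have TE : #|T| = (6 + (#|T| %/ 3 - 3) * 3 + 3)%N by lia.
  have := reach_odd_cycles (d := 1) (i := #|T| %/ 3 - 3) rch isT isT.
  move=> /(_ ltac:(lia)) {}rch.
  have := reach_attach_split (d := 3) rch isT _ erefl; rewrite -TE => /(_ (leqnn _)) {}rch.
  by apply: triple_head_large UH rch _; apply: cop; lia.
have TE : #|T| = (6 + (#|T| %/ 3 - 2) * 3 + #|T| %% 3)%N by lia.
have := reach_odd_cycles (d := 1) (i := #|T| %/ 3 - 2) rch isT isT.
move=> /(_ ltac:(lia)) {}rch.
set s := (_ + _).+1 in rch.
have rs : #|T| %% 3 <= s by rewrite /s; lia.
rewrite -(subnK rs) in rch.
have := reach_single rch; rewrite -TE => /(_ (leqnn _)) {}rch.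
by apply: triple_head_large UH rch _; apply: cop; lia.
Qed.

End Families.

(** * Two long cycles with few common points *)

Section TwoCycles.
Variable T : finType.
Implicit Types (p a b u v : T) (A B : seq T) (G : {group {perm T}}).

Lemma cyc_cat p A B : cyc (p :: A) * cyc (p :: B) = cyc (p :: A ++ B).
Proof. by rewrite /= big_cat. Qed.

Lemma cycJ s (g : {perm T}) : cyc s ^ g = cyc (map g s).
Proof.
case: s => [|x s] /=; first by rewrite conj1g.
elim: s => [|y s IH]; first by rewrite /= !big_nil conj1g.
by rewrite /= !big_cons conjMg tpermJ IH.
Qed.

Lemma uniq_cons_cat p A B : uniq (p :: A ++ B) -> uniq (p :: A) /\ uniq (p :: B).
Proof.
rewrite !cons_uniq mem_cat negb_or cat_uniq.
by case/andP=> [/andP[-> ->]] /and3P[-> _ ->].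
Qed.

(* (xy)^-1 (yx) is the square of the 3-cycle when the cycles x and y meet in p only. *)
Lemma shared_point_cyc3 G p a b A B : uniq (p :: (a :: A) ++ b :: B) ->
  cyc (p :: a :: A) \in G -> cyc (p :: b :: B) \in G -> cyc [:: p; b; a] \in G.
Proof.
move=> U xG yG.
have [Ua Ub] : uniq (a :: A) /\ uniq (b :: B).
  by move: U; rewrite cons_uniq cat_uniq => /andP[_]; move=> /and3P[-> _ ->].
have dis : [disjoint [set x in a :: A] & [set x in b :: B]].
  move: U; rewrite cons_uniq cat_uniq => /andP[_]; move=> /and3P[_ H _].
  rewrite disjoint_sym disjoint_subset; apply/subsetP=> y; rewrite in_set => yB.
  by rewrite inE in_set; apply: (hasPn H y yB).
have [pA pB] : p \notin a :: A /\ p \notin b :: B.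
  by move: U; rewrite cons_uniq mem_cat => /andP[+ _]; rewrite negb_or => /andP[].
have [aB bA ab] : [/\ a \notin b :: B, b \notin a :: A & a != b].
  have D y : y \in a :: A -> y \in b :: B -> False.
    by move=> yA yB; have := disjointFr dis; move/(_ y); rewrite !in_set yA yB => /(_ isT).
  have aB : a \notin b :: B by apply/negP => /D; apply; rewrite mem_head.
  split=> //; first by apply/negP => /D; apply; rewrite mem_head.
  by move: aB; rewrite inE negb_or => /andP[].
have pb : p != b /\ p \notin B by move: pB; rewrite inE negb_or => /andP[].
have pa : p != a /\ p \notin A by move: pA; rewrite inE negb_or => /andP[].
have aA : a \notin A by case/andP: Ua.
have bB : b \notin B by case/andP: Ub.
have U3 : uniq [:: p; b; a] by rewrite /= !inE negb_or pb.1 pa.1 eq_sym ab.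
have com : commute (cyc (a :: A)) (cyc (b :: B)).
  exact: perm_onC (cyc_perm_on Ua) (cyc_perm_on Ub) dis.
have coma : commute (tperm p a) (cyc (b :: B)).
  rewrite /commute [LHS]conjgC tpermJ !cyc_id //.
have comb : commute (tperm p b) (cyc (a :: A)).
  rewrite /commute [LHS]conjgC tpermJ !cyc_id //.
have E1 : cyc (p :: a :: A) * cyc (p :: b :: B) =
          cyc (a :: A) * cyc (b :: B) * (tperm p a * tperm p b).
  by rewrite (cyc_cons pa.2 aA) (cyc_cons pb.2 bB) -!mulgA; congr (_ * _); rewrite !mulgA coma.
have E2 : cyc (p :: b :: B) * cyc (p :: a :: A) =
          cyc (a :: A) * cyc (b :: B) * (tperm p b * tperm p a).
  rewrite (cyc_cons pa.2 aA) (cyc_cons pb.2 bB) com -!mulgA; congr (_ * _).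
  by rewrite !mulgA comb.
have : (cyc (p :: a :: A) * cyc (p :: b :: B))^-1 * (cyc (p :: b :: B) * cyc (p :: a :: A)) \in G.
  by rewrite !(groupM, groupV).
rewrite E1 E2 invMg mulgA -[_ * _ * (_ * cyc _)]mulgA mulVg mulg1 invMg !tpermV -cyc3E.
move=> g2; have o3 : #[cyc [:: p; b; a]] = 3 by rewrite order_cyc.
rewrite -[cyc _]mulg1 -(expg_order (cyc [:: p; b; a])) o3 !expgS expg0 mulg1.
by rewrite mulgA groupM.
Qed.

Lemma orbit_full_cyc p A B : {subset predT <= p :: A ++ B} -> uniq (p :: A) -> uniq (p :: B) ->
  orbit_full p (cyc (p :: A)) (cyc (p :: B)).
Proof.
move=> full UA UB C pC sA sB v.
have /orP[|vB] : (v \in p :: A) || (v \in p :: B).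
- by have := full v isT; rewrite !inE mem_cat orbA => /orP[->//|->]; rewrite !orbT.
- by apply: cyc_stable UA (mem_head _ _) pC _ v => y _; apply: sA.
- by apply: (cyc_stable UB (mem_head _ _) pC _ vB) => y _; apply: sB.
Qed.

Definition Alt_pair k := exists x y : {perm T},
  [/\ #[x] = k, #[y] = k & <<[set x; y]>> = Alt T].

Lemma Alt_pairP k (x y : {perm T}) : #[x] = k -> #[y] = k -> ~~ odd_perm x ->
  ~~ odd_perm y -> Alt T \subset <<[set x; y]>> -> Alt_pair k.
Proof.
move=> xk yk ex ey AG; exists x, y; split=> //; apply/eqP; rewrite eqEsubset AG andbT.
by rewrite gen_subG; apply/subsetP=> _ /set2P[]->; rewrite Alt_even.
Qed.

Lemma enum_split (s : seq nat) : sumn s = #|T| ->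
  exists ss : seq (seq T), [/\ shape ss = s, uniq (flatten ss) & flatten ss =i predT].
Proof.
move=> sT; exists (reshape s (enum T)).
have fl : flatten (reshape s (enum T)) = enum T by apply: reshapeKr; rewrite sT cardE.
split; rewrite ?fl ?enum_uniq //; first by apply: reshapeKl; rewrite sT cardE.
by move=> x; rewrite mem_enum.
Qed.

Lemma Alt_pair_2k1 k : odd k -> 2 < k -> #|T| = (2 * k).-1 -> Alt_pair k.
Proof.
move=> ok k3 Tk.
have [|ss [shE U full]] := @enum_split [:: 1; k.-1; k.-1]%N.
  by rewrite Tk /=; lia.
case: ss shE U full => [|[|p [|? ?]] [|[|a A] [|[|b B] [|? ?]]]] //= [] //; try lia.
move=> Ak Bk; rewrite cats0 => U full.
have {}U : uniq (p :: (a :: A) ++ b :: B) := U.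
have [UA UB] := uniq_cons_cat U.
have xk : #[cyc (p :: a :: A)] = k by rewrite order_cyc //=; lia.
have yk : #[cyc (p :: b :: B)] = k by rewrite order_cyc //=; lia.
apply: (Alt_pairP xk yk); rewrite ?odd_cyc //=; try by rewrite ?Ak ?Bk; lia.
pose G := <<[set cyc (p :: a :: A); cyc (p :: b :: B)]>>%G; change (Alt T \subset G).
have [xG yG] : cyc (p :: a :: A) \in G /\ cyc (p :: b :: B) \in G by rewrite !mem_gen ?set21 ?set22.
have G3 := shared_point_cyc3 U xG yG.
have U3 : uniq [:: p; b; a].
  have pb : p != b by case/andP: UB; rewrite inE negb_or => /andP[].
  have pa : p != a by case/andP: UA; rewrite inE negb_or => /andP[].
  have ab : a != b.
    by case/and3P: U => _ + _; rewrite mem_cat inE !negb_or => /and3P[].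
  by rewrite /= !inE negb_or pb pa eq_sym ab.
have rpb : cyc3_rel G p b by apply/orP; right; apply/existsP; exists a; rewrite U3.
have rpa : cyc3_rel G p a.
  rewrite cyc3_rel_sym; apply/orP; right; apply/existsP; exists b.
  by rewrite (cyc3_rot (uniq3_rot U3)) (cyc3_rot U3) G3 (uniq3_rot (uniq3_rot U3)).
have orb : orbit_full p (cyc (p :: a :: A)) (cyc (p :: b :: B)).
  by apply: orbit_full_cyc => // y _; rewrite full.
(* The point p serves as both u and v, since its images a and b under the two generators are the
   other points of the 3-cycle. *)
apply: (cyc3_orbit_full xG yG orb (u := p) (v := p)).
- by rewrite /cyc3_rel eqxx.
- by rewrite cycE //= eqxx.
- by rewrite cycE //= eqxx.
Qed.

(* Here x = (u v B) and y = (u b1 v c B2): then x y = (u c B2) (v B b1) is a product of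
   cycles of coprime lengths k - 2 and k, and its factor (u c B2) meets x in u only. *)
Lemma Alt_pair_2k2 k : odd k -> 4 < k -> #|T| = (2 * k).-2 -> Alt_pair k.
Proof.
move=> ok k5 Tk.
have [|ss [shE U full]] := @enum_split [:: 3; k - 2; k - 3]%N.
  by rewrite Tk /=; lia.
case: ss shE U full => [|[|u [|v [|b1 [|? ?]]]] [|B [|B2 [|? ?]]]] //= [] //.
move=> Bk B2k; rewrite cats0 => U full.
case: B2 B2k U full => [|c B2] B2k U full; first by move: B2k => /=; lia.
have {}U : uniq (u :: [:: v; b1] ++ B ++ c :: B2) := U.
have [Uu [Uv [b1n UBB]]] : u \notin [:: v; b1] ++ B ++ c :: B2 /\
  v \notin b1 :: B ++ c :: B2 /\ b1 \notin B ++ c :: B2 /\ uniq (B ++ c :: B2).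
  by have /and4P[] := U.
have [uv ub1 uB uB2] : [/\ u != v, u != b1, u \notin B & u \notin c :: B2].
  by move: Uu; rewrite !mem_cat !negb_or => /and3P[+ -> ->]; case/and3P=> -> ->.
have [vb1 vB vB2] : [/\ v != b1, v \notin B & v \notin c :: B2].
  by move: Uv; rewrite inE mem_cat !negb_or => /and3P[].
have [b1B b1B2] : b1 \notin B /\ b1 \notin c :: B2.
  by move: b1n; rewrite mem_cat negb_or => /andP[].
have [UB UB2 BB2] : [/\ uniq B, uniq (c :: B2) & ~~ has (mem B) (c :: B2)].
  by move: UBB; rewrite cat_uniq => /and3P[].
have Ux : uniq (u :: v :: B) by rewrite !cons_uniq inE negb_or uv uB vB UB.
have Uy : uniq (u :: b1 :: v :: c :: B2).
  have E1 : u \notin [:: b1, v, c & B2] by rewrite in_cons negb_or ub1 in_cons negb_or uv.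
  have E2 : b1 \notin [:: v, c & B2] by rewrite in_cons negb_or eq_sym vb1.
  by rewrite cons_uniq E1 cons_uniq E2 cons_uniq vB2.
have Uw : uniq (u :: c :: B2) by rewrite cons_uniq uB2 UB2.
have Us : uniq (v :: rcons B b1).
  by rewrite cons_uniq mem_rcons inE negb_or vb1 vB rcons_uniq b1B UB.
set x := cyc (u :: v :: B); set y := cyc (u :: b1 :: v :: c :: B2).
set w := cyc (u :: c :: B2); set s := cyc (v :: rcons B b1).
have ws : commute w s.
  apply: perm_onC (cyc_perm_on Uw) (cyc_perm_on Us) _.
  rewrite disjoint_subset; apply/subsetP=> z; rewrite in_set => zw; rewrite inE in_set.
  apply/negP; rewrite inE mem_rcons inE => zs.
  have uS : (u == v) || ((u == b1) || (u \in B)) = false.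
    by rewrite (negPf uv) (negPf ub1) (negPf uB).
  move: zw; rewrite inE => /orP[/eqP zu|zw]; first by rewrite zu uS in zs.
  case/or3P: zs => [/eqP zv|/eqP zb|zB]; first by rewrite zv (negPf vB2) in zw.
    by rewrite zb (negPf b1B2) in zw.
  by move/hasPn: BB2 => /(_ z zw); rewrite /= zB.
have xyE : x * y = w * s.
  have -> : y = tperm u b1 * cyc (v :: c :: B2) * tperm u v.
    by rewrite -cyc2 cyc_merge.
  have -> : x = cyc (v :: B) * tperm u v by rewrite /x cyc_cons.
  rewrite ws; have -> : s = cyc (v :: B) * tperm v b1.
    by rewrite /s -cats1 -cyc_cat cyc2.
  (* What stands between the two factors [tperm u v] is conjugated by it: (u b1) becomes (v b1), and
     the cycle (v c B2) becomes w. *)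
  rewrite -!mulgA; congr (_ * _).
  have -> : tperm v b1 = tperm u b1 ^ tperm u v by rewrite tpermJ tpermL tpermD // eq_sym.
  have -> : w = cyc (v :: c :: B2) ^ tperm u v.
    rewrite cycJ /w map_cons tpermR; congr (cyc (_ :: _)).
    by rewrite map_id_in // => z zB; rewrite tpermD //; apply: contraTneq zB => <-.
  by rewrite -conjMg conjgE tpermV !mulgA.
have sx : size (u :: v :: B) = k by clear -Bk k5; move: Bk => /=; lia.
have xk : #[x] = k by rewrite order_cyc.
have sy : size (u :: b1 :: v :: c :: B2) = k by clear -B2k k5; move: B2k => /=; lia.
have yk : #[y] = k by rewrite order_cyc.
have ek : ~~ odd k.-1 by clear -ok k5; lia.
apply: (Alt_pairP xk yk); first by rewrite odd_cyc ?sx.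
  by rewrite odd_cyc ?sy.
pose G := <<[set x; y]>>%G; change (Alt T \subset G).
have [xG yG] : x \in G /\ y \in G by rewrite !mem_gen ?set21 ?set22.
have wG : w \in G.
  have sk : #[s] = k.
    by rewrite order_cyc // [size _]/= size_rcons Bk; clear -k5; lia.
  have : w \in <[w * s]>.
    apply: (mem_cycle_mul (m := k) ws); first by rewrite -sk expg_order.
    rewrite order_cyc //; have -> : size (u :: c :: B2) = k - 2 by clear -B2k k5; move: B2k => /=; lia.
    have k2 : 2 <= k by clear -k5; lia.
    have /eqP : coprime (k - 2) 2 by rewrite coprimen2; clear -ok k5; lia.
    by rewrite -gcdnDl subnK // => E; apply/eqP.
  by apply/subsetP; rewrite cycle_subG -xyE groupM.
have U' : uniq (u :: (v :: B) ++ c :: B2).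
  have E1 : u \notin (v :: B) ++ c :: B2.
    by rewrite mem_cat negb_or uB2 andbT in_cons negb_or uv.
  have E2 : uniq (v :: B) by rewrite cons_uniq vB.
  rewrite cons_uniq E1 cat_uniq E2 UB2 andbT.
  by apply/hasPn=> z zB; rewrite /= inE negb_or (hasPn BB2 z zB) andbT; apply: contraTneq zB => ->.
have G3 := shared_point_cyc3 U' xG wG.
have U3 : uniq [:: u; c; v].
  move: uB2 vB2; rewrite !inE !negb_or => /andP[uc _] /andP[vc _].
  by rewrite /= !inE negb_or uc uv eq_sym vc.
have ruc : cyc3_rel G u c by apply/orP; right; apply/existsP; exists v; rewrite U3.
have ruv : cyc3_rel G u v.
  rewrite cyc3_rel_sym; apply/orP; right; apply/existsP; exists c.
  by rewrite (cyc3_rot (uniq3_rot U3)) (cyc3_rot U3) G3 (uniq3_rot (uniq3_rot U3)).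
have orb : orbit_full u x y.
  move=> C uC xC yC z.
  have Cx : {subset u :: v :: B <= C}.
    by apply: cyc_stable Ux (mem_head _ _) uC _ => t _; apply: xC.
  have Cy : {subset u :: b1 :: v :: c :: B2 <= C}.
    by apply: cyc_stable Uy (mem_head _ _) uC _ => t _; apply: yC.
  have := full z; rewrite !in_cons mem_cat in_cons => zT.
  have /orP[/Cx//|/Cy//] : (z \in u :: v :: B) || (z \in u :: b1 :: v :: c :: B2).
    rewrite !in_cons.
  by case/or4P: zT => [->|->|->|/orP[->|->]]; rewrite ?orbT.
apply: (cyc3_orbit_full xG yG orb ruv).
- by rewrite /x cycE //= eqxx.
- have -> : y v = c.
    by rewrite /y cycE //= (negPf vb1) eq_sym (negPf uv) eqxx.
  by apply: cyc3_rel_trans ruc; rewrite cyc3_rel_sym.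
Qed.

End TwoCycles.

(** * Explicit generators for the small exceptional cases *)

Section Explicit.
Variables (n : nat).
Implicit Types (c : seq (seq nat)) (s : seq nat).

Definition perm_of c : {perm 'I_n.+1} := \prod_(s <- c) cyc [seq inord i | i <- s].

(** The action of [perm_of c] transferred to natural numbers, where the tests of a certificate can
    be decided by evaluation. *)
Definition eval_cycles c i := foldl (fun j s => next s j) i c.

Definition eval_word cx cy (w : seq bool) i :=
  foldl (fun j (b : bool) => eval_cycles (if b then cx else cy) j) i w.

Definition wf_cycles c := [&& uniq (flatten c), all (leq^~ n) (flatten c) & [::] \notin c].

Lemma map_val_inord s : all (leq^~ n) s -> [seq val j | j <- [seq inord i : 'I_n.+1 | i <- s]] = s.
Proof.
move=> /allP sn; rewrite -map_comp map_id_in // => i /sn i_n /=.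
by rewrite inordK.
Qed.

Lemma wf_cons s c : wf_cycles (s :: c) ->
  [/\ wf_cycles c, uniq [seq inord i : 'I_n.+1 | i <- s], all (leq^~ n) s, s != [::] &
      [disjoint [set i in [seq inord i : 'I_n.+1 | i <- s]] & [set i : 'I_n.+1 | val i \in flatten c]]].
Proof.
case/and3P=> /=; rewrite cat_uniq all_cat => /and3P[Us dis Uc] /andP[sn cn].
rewrite inE negb_or eq_sym => /andP[s0 c0]; split=> //; first by rewrite /wf_cycles Uc cn c0.
  by rewrite -(map_inj_uniq val_inj) map_val_inord.
rewrite disjoint_subset; apply/subsetP=> i; rewrite !inE => /mapP[j js ->].
rewrite inordK ?ltnS ?(allP sn) //; apply/negP=> jc.
by move/hasPn: dis => /(_ j jc); rewrite /= js.
Qed.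

Lemma perm_of_on c : wf_cycles c -> perm_on [set i : 'I_n.+1 | val i \in flatten c] (perm_of c).
Proof.
elim: c => [|s c IH]; first by rewrite /perm_of big_nil perm_on1.
case/wf_cons=> wc Us sn s0 dis; rewrite /perm_of big_cons; apply: perm_onM.
  apply: perm_on_sub (cyc_perm_on Us); apply/subsetP=> i; rewrite !in_set mem_cat.
  by case/mapP=> j js ->; rewrite /= inordK ?js // ltnS; exact: (allP sn).
by apply: perm_on_sub (IH wc); apply/subsetP=> i; rewrite !in_set mem_cat => ->; rewrite orbT.
Qed.

Lemma perm_ofE c (i : 'I_n.+1) : wf_cycles c -> val (perm_of c i) = eval_cycles c (val i).
Proof.
elim: c i => [|s c IH] i; first by rewrite /perm_of big_nil perm1.
case/wf_cons=> wc Us sn s0 dis; rewrite /perm_of big_cons permM IH //=.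
by rewrite cycE // -(next_map val_inj) // map_val_inord.
Qed.

Lemma order_perm_of c : wf_cycles c -> #[perm_of c] = foldr lcmn 1%N (map size c).
Proof.
elim: c => [|s c IH]; first by rewrite /perm_of big_nil order1.
case/wf_cons=> wc Us sn s0 dis; rewrite /perm_of big_cons.
rewrite (order_mul_disjoint (cyc_perm_on Us) (perm_of_on wc) dis) IH //.
by rewrite order_cyc ?size_map //; case: s s0 {Us sn dis}.
Qed.

Lemma odd_perm_of c : wf_cycles c -> odd_perm (perm_of c) = odd (sumn (map (fun s => (size s).-1) c)).
Proof.
elim: c => [|s c IH]; first by rewrite /perm_of big_nil odd_perm1.
case/wf_cons=> wc Us sn s0 dis; rewrite /perm_of big_cons odd_permM IH //=.
by rewrite odd_cyc // size_map oddD.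
Qed.

Definition spread cx cy (S : seq nat) :=
  undup (S ++ map (eval_cycles cx) S ++ map (eval_cycles cy) S).

(* The word w in the two permutations equals the 3-cycle (p q r). *)
Definition certificate k cx cy w p q r :=
  [&& wf_cycles cx && wf_cycles cy,
      (foldr lcmn 1%N (map size cx) == k) && (foldr lcmn 1%N (map size cy) == k),
      uniq [:: p; q; r] && all (leq^~ n) [:: p; q; r],
      all (fun i => eval_word cx cy w i == next [:: p; q; r] i) (iota 0 n.+1),
      all (mem (iter n (spread cx cy) [:: p])) (iota 0 n.+1),
      has (fun u => eval_cycles cx u \in [:: p; q; r]) [:: p; q; r] &
      has (fun u => eval_cycles cy u \in [:: p; q; r]) [:: p; q; r]].

(** The word puts the 3-cycle (p q r) into the group, and n rounds of [spread] prove transitivity.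
    The last two tests provide points u, v of the 3-cycle whose images under the respective
    generators stay among p, q, r, as [cyc3_orbit_full] requires. *)
Lemma certificateP k cx cy w p q r : certificate k cx cy w p q r ->
  [/\ #[perm_of cx] = k, #[perm_of cy] = k &
      Alt 'I_n.+1 \subset <<[set perm_of cx; perm_of cy]>>].
Proof.
case/and5P=> /andP[wx wy] /andP[/eqP ox /eqP oy] /andP[U le] wE /and3P[sp hx hy].
split; rewrite ?order_perm_of //.
pose G := <<[set perm_of cx; perm_of cy]>>%G; change (Alt 'I_n.+1 \subset G).
have [xG yG] : perm_of cx \in G /\ perm_of cy \in G by rewrite !mem_gen ?set21 ?set22.
pose t := [seq inord i : 'I_n.+1 | i <- [:: p; q; r]].
have Ut : uniq t by rewrite -(map_inj_uniq val_inj) map_val_inord.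
have evw (i : 'I_n.+1) : val ((\prod_(b <- w) if b then perm_of cx else perm_of cy) i) = eval_word cx cy w (val i).
  elim: w i {wE} => [|b w IH] i; first by rewrite big_nil perm1.
  rewrite big_cons permM IH /=; congr (eval_word _ _ _ _).
  by case: b; rewrite perm_ofE.
have tG : cyc t \in G.
  have -> : cyc t = \prod_(b <- w) if b then perm_of cx else perm_of cy.
    apply/permP=> i; apply: val_inj; rewrite evw cycE // -(next_map val_inj) // map_val_inord //.
    by apply/esym/eqP/(allP wE); rewrite mem_iota ltn_ord.
  by elim/big_rec: _ => [|b g _ gG]; [exact: group1|case: b; rewrite groupM].
have rel u v : u \in t -> v \in t -> cyc3_rel G u v.
  have rot1 := cyc3_rot Ut; have U1 := uniq3_rot Ut.
  have r12 : cyc3_rel G (inord p) (inord q).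
    by apply/orP; right; apply/existsP; exists (inord r); rewrite [X in X && _]Ut tG.
  have r23 : cyc3_rel G (inord q) (inord r).
    by apply/orP; right; apply/existsP; exists (inord p); rewrite [X in X && _]U1 rot1 tG.
  have r13 := cyc3_rel_trans r12 r23.
  rewrite !inE => /or3P[]/eqP-> /or3P[]/eqP->; rewrite // 1?cyc3_rel_sym // /cyc3_rel ?eqxx //.
have meets c : wf_cycles c -> has (fun u => eval_cycles c u \in [:: p; q; r]) [:: p; q; r] ->
    exists2 u, u \in t & perm_of c u \in t.
  move=> wc /hasP[u uT cuT]; exists (inord u); first exact: map_f.
  have un : u <= n by apply: (allP le).
  apply/mapP; exists (eval_cycles c u) => //; apply: val_inj.
  rewrite perm_ofE // /= !inordK ?ltnS //; exact: (allP le).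
have [u ut xu] := meets cx wx hx; have [v vt yv] := meets cy wy hy.
have orb : orbit_full (inord p) (perm_of cx) (perm_of cy).
  move=> B pB xB yB i.
  have /allP/(_ (val i)) := sp; rewrite mem_iota ltn_ord => /(_ isT) iS.
  pose inB l := exists2 j : 'I_n.+1, val j = l & j \in B.
  have reach m l : l \in iter m (spread cx cy) [:: p] -> inB l.
    elim: m l => [|m IH] l /=.
      rewrite inE => /eqP->; exists (inord p) => //.
      by rewrite /= inordK // ltnS; apply: (allP le); rewrite mem_head.
    rewrite mem_undup !mem_cat => /or3P[/IH//||] /mapP[l' /IH[j <- jB] ->].
      by exists (perm_of cx j); [rewrite perm_ofE | apply: xB].
    by exists (perm_of cy j); [rewrite perm_ofE | apply: yB].
  by have [j /val_inj <-] := reach _ _ iS.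
by apply: (cyc3_orbit_full xG yG orb (rel u v ut vt)); apply: rel.
Qed.

Lemma dk_certificate k cx cy w p q r : 2 < n -> certificate k cx cy w p q r ->
  dk_is k (if odd (sumn (map (fun s => (size s).-1) cx)) || odd (sumn (map (fun s => (size s).-1) cy))
           then Sym 'I_n.+1 else Alt 'I_n.+1) 2.
Proof.
move=> n2 ce; have [xk yk AG] := certificateP ce.
have /and5P[/andP[wx wy] _ _ _ _] := ce.
rewrite -!odd_perm_of //.
have nA : ~~ abelian (Alt 'I_n.+1) by apply: Alt_nonabelian; rewrite card_ord.
case: ifP => [o|/norP[ox oy]].
  have nS : ~~ abelian (Sym 'I_n.+1) by apply: contra nA; apply: abelianS; apply: Alt_subset.
  apply: dk_is2 xk yk _ nS; apply/eqP; rewrite eqEsubset subsetT /=.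
  apply/subsetP=> g _.
  have [h [hG oh]] : exists h, h \in <<[set perm_of cx; perm_of cy]>> /\ odd_perm h.
    by case/orP: o => o; [exists (perm_of cx)|exists (perm_of cy)]; rewrite mem_gen ?set21 ?set22.
  have [og|eg] := boolP (odd_perm g); last by rewrite (subsetP AG) // Alt_even.
  rewrite -[g](mulgK h) groupM ?groupV // (subsetP AG) //.
  by rewrite Alt_even odd_permM og oh.
apply: dk_is2 xk yk _ nA; apply/eqP; rewrite eqEsubset AG andbT.
by rewrite gen_subG; apply/subsetP=> _ /set2P[]->; rewrite Alt_even.
Qed.

End Explicit.

(* Witnesses found by computer search. *)
Section Certificates.
Local Notation X := true.
Local Notation Y := false.

Lemma dk_A4_3 : dk_is 3 (Alt 'I_4) 2.
(* The first argument is the degree minus one, since the permutations act on ['I_n.+1]. *)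
Proof. exact: (@dk_certificate 3 3 [:: [:: 0; 2; 3]] [:: [:: 0; 3; 1]] [:: X] 0 2 3)%N. Qed.

Lemma dk_A6_3 : dk_is 3 (Alt 'I_6) 2.
Proof. exact: (@dk_certificate 5 3 [:: [:: 0; 5; 2]] [:: [:: 0; 3; 1]; [:: 2; 5; 4]] [:: X] 0 5 2)%N. Qed.

Lemma dk_A8_3 : dk_is 3 (Alt 'I_8) 2.
Proof.
exact: (@dk_certificate 7 3 [:: [:: 0; 3; 4]; [:: 1; 5; 6]] [:: [:: 2; 3; 5]; [:: 4; 7; 6]]
  (flatten (nseq 5 [:: X; Y])) 0 4 5)%N.
Qed.

Lemma dk_S4_4 : dk_is 4 (Sym 'I_4) 2.
Proof. exact: (@dk_certificate 3 4 [:: [:: 0; 3; 2; 1]] [:: [:: 0; 1; 3; 2]] [:: X; Y] 0 2 3)%N. Qed.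

Lemma dk_S6_4 : dk_is 4 (Sym 'I_6) 2.
Proof.
exact: (@dk_certificate 5 4 [:: [:: 0; 4; 2; 5]] [:: [:: 0; 3; 5; 1]] (flatten (nseq 2 [:: X; Y; Y])) 0 2 4)%N.
Qed.

Lemma dk_S7_4 : dk_is 4 (Sym 'I_7) 2.
Proof.
exact: (@dk_certificate 6 4 [:: [:: 1; 2; 5; 4]] [:: [:: 0; 5; 3; 6]] (flatten (nseq 2 [:: X; X; Y; Y])) 1 5 6)%N.
Qed.

Lemma dk_S8_4 : dk_is 4 (Sym 'I_8) 2.
Proof.
exact: (@dk_certificate 7 4 [:: [:: 0; 2]; [:: 1; 4; 6; 5]] [:: [:: 0; 6]; [:: 1; 5; 7; 4]; [:: 2; 3]]
  [:: X; Y; Y; X] 4 5 7)%N.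
Qed.

Lemma dk_A6_4 : dk_is 4 (Alt 'I_6) 2.
Proof.
exact: (@dk_certificate 5 4 [:: [:: 0; 1; 2; 3]; [:: 4; 5]] [:: [:: 0; 1]; [:: 2; 5; 3; 4]] [:: X; Y; Y] 0 1 3)%N.
Qed.

Lemma dk_A10_4 : dk_is 4 (Alt 'I_10) 2.
Proof.
exact: (@dk_certificate 9 4 [:: [:: 0; 5; 3; 8]; [:: 1; 2; 4; 6]] [:: [:: 0; 7; 8; 9]; [:: 1; 3; 6; 5]]
  (flatten (nseq 2 [:: X; Y; Y])) 1 4 2)%N.
Qed.

Lemma dk_A7_6 : dk_is 6 (Alt 'I_7) 2.
Proof.
exact: (@dk_certificate 6 6 [:: [:: 0; 3]; [:: 1; 2]; [:: 4; 5; 6]] [:: [:: 0; 5]; [:: 1; 2; 6]; [:: 3; 4]]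
  [:: Y; Y] 1 6 2)%N.
Qed.

End Certificates.

(* Assembly of the cases according to k and n *)
Local Close Scope group_scope.

Lemma dk_large_pair (T : finType) (k : nat) (e : bool) : 4 < #|T| -> 2 < k ->
  large_pair T k e -> dk_is k (if e then Sym T else Alt T) 2.
Proof.
move=> T5 k3 [a [t [ao ae tt AG]]].
have gG := gen_conj_involution T5 k3 ao tt AG; rewrite ae in gG.
have nA : ~~ abelian (Alt T) by apply: Alt_nonabelian; lia.
have nS : ~~ abelian (Sym T) by apply: contra nA; apply: abelianS; apply: Alt_subset.
have atk : #[a ^ t]%g = k by rewrite orderJ.
by case: e {ae} gG => gG; apply: dk_is2 ao atk gG _.
Qed.

Lemma dk_Alt_pair (T : finType) (k : nat) : 3 < #|T| -> Alt_pair T k -> dk_is k (Alt T) 2.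
Proof.
move=> T4 [x [y [xk yk gG]]].
exact: dk_is2 xk yk gG (Alt_nonabelian T4).
Qed.

Lemma dk_Sym_even n k : 2 < k -> k <= n -> ~~ odd k -> dk_is k (Sym 'I_n) 2.
Proof.
move=> k3 kn ek.
have [k4|k4] := eqVneq k 4.
  subst k; have [->|n4] := eqVneq n 4; first exact: dk_S4_4.
  have [|] := boolP (n \in [:: 6; 7; 8]).
    by rewrite !inE => /or3P[]/eqP->; [exact: dk_S6_4|exact: dk_S7_4|exact: dk_S8_4].
  move=> nn; apply: (@dk_large_pair _ _ true); rewrite ?card_ord //; first by lia.
  by apply: large4; rewrite card_ord //; lia.
apply: (@dk_large_pair _ _ true); rewrite ?card_ord //; first by lia.
by apply: large_even_true; rewrite ?card_ord; lia.
Qed.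

(** From n = k + 2 on there is room for a 2-cycle beside a k-cycle. For smaller n, k is written as b
    * 2 ^ r with b odd; the excluded powers of 2 are those with b = 1, and r = 1 is separated
    because a b-cycle then needs two 2-cycles to become even of order k. *)
Lemma dk_Alt_even n k : 2 < k -> k <= n -> ~~ odd k ->
  ~ ((k \in [:: n.-1; n]) /\ (exists e, k = 2 ^ e)) -> ~ (n = 6 /\ k = 6) ->
  dk_is k (Alt 'I_n) 2.
Proof.
move=> k3 kn ek npow n66.
have [k4|k4] := eqVneq k 4.
  subst k.
  have n6 : 5 < n.
    rewrite ltnNge; apply/negP=> n5; apply: npow; split; last by exists 2.
    by rewrite !inE; lia.
  have [->|nn6] := eqVneq n 6; first exact: dk_A6_4.
  have [->|n10] := eqVneq n 10; first exact: dk_A10_4.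
  apply: (@dk_large_pair _ _ false); rewrite ?card_ord //; first by lia.
  by apply: large4; rewrite card_ord ?inE; lia.
have n5 : 4 < n by lia.
have [k2|k2] := leqP (k + 2) n.
  apply: (@dk_large_pair _ _ false); rewrite ?card_ord //.
  by apply: large_even_false; rewrite ?card_ord; lia.
have kin : k \in [:: n.-1; n] by rewrite !inE; lia.
have k0 : 0 < k by lia.
have [b cb kE] := pfactor_coprime (isT : prime 2) k0.
set r := logn 2 k in kE.
have ob : odd b by rewrite -coprime2n.
have b1 : b != 1.
  by apply: contra_notN npow => /eqP bE; split=> //; exists r; rewrite kE bE mul1n.
have b3 : 2 < b by lia.
case: r kE => [|[|r]] kE.
- by rewrite kE expn0 muln1 ob in ek.
- have {}kE : k = b.*2 by rewrite kE expn1 muln2.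
  have [b3E|b3E] := eqVneq b 3.
    have [n6|n7] : n = 6 \/ n = 7 by lia.
      by case: n66; split=> //; rewrite kE b3E.
    by rewrite n7 kE b3E; exact: dk_A7_6.
  apply: (@dk_large_pair _ _ false); rewrite ?card_ord // kE.
  by apply: large_double_false; rewrite ?card_ord; lia.
- apply: (@dk_large_pair _ _ false); rewrite ?card_ord // kE mulnC.
  by apply: large_mul4_false; rewrite ?card_ord // mulnC -kE.
Qed.

Lemma dk_Alt_odd n k : 2 < k -> k <= n -> odd k -> n != 3 -> dk_is k (Alt 'I_n) 2.
Proof.
move=> k3 kn ok n3.
have [k3E|nk3] := eqVneq k 3.
  subst k; have [->|n4] := eqVneq n 4; first exact: dk_A4_3.
  have [->|n6] := eqVneq n 6; first exact: dk_A6_3.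
  have [->|n8] := eqVneq n 8; first exact: dk_A8_3.
  (* For k = 3 this is the degree 2k - 1. *)
  have [n5|n5] := eqVneq n 5.
    by apply: dk_Alt_pair; rewrite ?card_ord ?n5 //; apply: Alt_pair_2k1; rewrite ?card_ord.
  apply: (@dk_large_pair _ _ false); rewrite ?card_ord //; first by lia.
  by apply: large3; rewrite card_ord; lia.
have k5 : 4 < k by lia.
have [n1|n1] := eqVneq n (2 * k).-1.
  apply: dk_Alt_pair; rewrite ?card_ord //; first by lia.
  by apply: Alt_pair_2k1; rewrite ?card_ord.
have [n2|n2] := eqVneq n (2 * k).-2.
  apply: dk_Alt_pair; rewrite ?card_ord //; first by lia.
  by apply: Alt_pair_2k2; rewrite ?card_ord.
apply: (@dk_large_pair _ _ false); rewrite ?card_ord //; first by lia.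
by apply: large_odd; rewrite ?card_ord; lia.
Qed.

Theorem theorem1p1 (n k : nat) (hk : 3 <= k) (hkn : k <= n) :
  (~~ odd k ->
     dk_is k (Sym 'I_n) 2 /\
     (~ ((k \in [:: n.-1; n]) /\ (exists e, k = 2 ^ e)) -> ~ (n = 6 /\ k = 6) ->
        dk_is k (Alt 'I_n) 2)) /\
  (odd k ->
     (n != 3 -> dk_is k (Alt 'I_n) 2) /\
     (n = 3 -> dk_is k (Alt 'I_n) 1)).
Proof.
split=> [ek|ok]; split.
- exact: dk_Sym_even.
- exact: dk_Alt_even.
- exact: dk_Alt_odd.
- by move=> n3; subst n; rewrite (_ : k = 3); [exact: order3_A3 | lia].
Qed.
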